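(* Let $(\mathcal A,\bullet,\omega)$ be a symplectic left Leibniz algebra with core $(\mathfrak g,[\,,]_{\mathfrak g},\omega_{\mathfrak g})$ and $\mathfrak h$. Then $(\mathcal A,\bullet,\omega)$ is isomorphic to $(\mathfrak h\oplus\mathfrak g\oplus\mathfrak h^*,\circ,\omega_n)$ where, for $X,Y\in\mathfrak h$, $a,b\in\mathfrak g$, $\alpha,\beta\in\mathfrak h^*$, $$(\ast)\quad\begin{cases}X\circ Y=\theta(X,Y)+\Omega(X)(Y,\cdot),\qquad a\circ b=[a,b]_{\mathfrak g}+\omega_{\mathfrak g}(K(\cdot)a,b),\\ X\circ a=F(X)a+\omega_{\mathfrak g}(\psi(X,\cdot),a),\qquad a\circ X=G(X)a+\omega_{\mathfrak g}(\xi(X,\cdot),a),\\ \alpha\circ u=u\circ\alpha=0\ \text{ for all } u\in\mathfrak h\oplus\mathfrak g\oplus\mathfrak h^*,\\ \omega_n(X+a+\alpha,Y+b+\beta)=\langle\alpha,Y\rangle-\langle\beta,X\rangle+\omega_{\mathfrak g}(a,b),\end{cases}$$ for some linear maps $F,G:\mathfrak h\to\mathrm{Der}(\mathfrak g)$, $\Omega:\mathfrak h\to\mathfrak h^*\otimes\mathfrak h^*$ and bilinear maps $\theta,\psi,\xi:\mathfrak h\times\mathfrak h\to\mathfrak g$ such that, with $S(X)=F(X)+G(X)$ and $K(X)=\frac12S(X)-F(X)-F(X)^*$, for all $X,Y,Z,T\in\mathfrak h$ and $a,b\in\mathfrak g$: $$(\ast\ast)\quad\begin{cases} \Omega(X)(Z,Y)-\Omega(Y)(Z,X)=\frac12\Omega(X)(Y,Z)-\frac12\Omega(Y)(X,Z),\\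 \psi(X,Y)-\psi(Y,X)=\xi(Y,X)-\xi(X,Y),\\ \theta(X,Y)=\xi(Y,X)+\frac12\psi(X,Y)-\frac12\xi(X,Y),\\ \omega_{\mathfrak g}(\theta(X,Y),\xi(Z,T))-\omega_{\mathfrak g}(\theta(Y,Z),\psi(X,T))+\omega_{\mathfrak g}(\theta(X,Z),\psi(Y,T))=0,\\ F(X)\theta(Y,Z)-F(Y)\theta(X,Z)+F(Z)\theta(X,Y)=S(Z)\theta(X,Y),\\ F(X)^*\psi(Y,Z)-F(Y)^*\psi(X,Z)+K(Z)\theta(X,Y)=0,\\ F(X)^*(\psi(Y,Z)+\xi(Y,Z))+S(Y)\psi(X,Z)+S(Z)\theta(X,Y)=0,\\ \mathrm{ad}^{\mathfrak g}_{\theta(X,Y)}=[F(X),F(Y)],\\ \mathrm R^{\star_{\mathfrak g}}_{\psi(X,Y)}=(F(Y)+F(Y)^* )F(X)+F(X)^*(F(Y)+F(Y)^* ),\\ \mathrm R^{\star_{\mathfrak g}}_{\psi(X,Y)+\xi(X,Y)}=0,\\ S(X)(a\star_{\mathfrak g}b)=0,\quad S(X)^*=-S(X),\quad S(X)\xi(Y,Z)=0,\\ S(X)S(Y)=F(X)S(Y)=S(X)F(Y)=0. \end{cases}$$ Conversely, if $(\mathfrak g,[\,,]_{\mathfrak g},\omega_{\mathfrak g})$ is a symplectic Lie algebra, $\mathfrak h$ is a vector space (viewed as a trivial algebra), and $F,G:\mathfrak h\to\mathrm{Der}(\mathfrak g)$, $\Omega:\mathfrak h\to\mathfrak h^*\otimes\mathfrak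 h^*$ (linear), $\theta,\psi,\xi:\mathfrak h\times\mathfrak h\to\mathfrak g$ (bilinear) satisfy $(\ast\ast)$ (with $S(X)=F(X)+G(X)$ and $K(X)=\frac12S(X)-F(X)-F(X)^*$ for $X\in\mathfrak h$), then $(\mathfrak h\oplus\mathfrak g\oplus\mathfrak h^*,\circ,\omega_n)$ with $(\circ,\omega_n)$ given by $(\ast)$ is a symplectic left Leibniz algebra.
   Context: All algebras and vector spaces are finite-dimensional over a field $\mathbb K$ of characteristic $0$. A left Leibniz algebra is an algebra $(\mathcal A,\bullet)$ with $u\bullet(v\bullet w)=(u\bullet v)\bullet w+v\bullet(u\bullet w)$; $\mathrm L_uv=u\bullet v$, $[u,v]=\frac12(u\bullet v-v\bullet u)$. A symplectic left Leibniz algebra $(\mathcal A,\bullet,\omega)$ is a left Leibniz algebra with a nondegenerate skew-symmetric bilinear form $\omega$ such that $\mathrm L_v^*u-\mathrm L_u^*v=[u,v]$ for all $u,v$, where $^*$ is the adjoint with respect to $\omega$ ($\omega(Tu,v)=\omega(u,T^*v)$). Isomorphisms are algebra isomorphisms carrying one form to the other. Core: let $\mathrm{Leib}(\mathcal A)=\mathrm{span}\{u\bullet v+v\bullet u\}$ and $I=\mathrm{Leib}(\mathcal A)\cap\mathrm{Leib}(\mathcal A)^\perp$ ($\perp$ with respect to $\omega$). Then $I$ is an isotropic ideal, $I^\perp$ is an ideal, $\mathfrak g=I^\perp/I$ with the induced product (denoted $[\,,]_{\mathfrak g}$) and induced form $\omega_{\mathfrak g}$ is a symplectic Lie algebra,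 and $\mathfrak h=\mathcal A/I^\perp$ (a vector space, i.e. a trivial algebra). The pair $(\mathfrak g,[\,,]_{\mathfrak g},\omega_{\mathfrak g})$, $\mathfrak h$ is the core of $(\mathcal A,\bullet,\omega)$. A symplectic Lie algebra is a Lie algebra $(\mathfrak g,[\,,]_{\mathfrak g})$ with a nondegenerate skew-symmetric form $\omega_{\mathfrak g}$ such that $\omega_{\mathfrak g}([a,b],c)+\omega_{\mathfrak g}([b,c],a)+\omega_{\mathfrak g}([c,a],b)=0$. Its associated left symmetric product is $a\star_{\mathfrak g}b=-(\mathrm{ad}^{\mathfrak g}_a)^*b$, with right multiplications $\mathrm R^{\star_{\mathfrak g}}_ba=a\star_{\mathfrak g}b$. On $\mathrm{End}(\mathfrak g)$, $^*$ is the adjoint with respect to $\omega_{\mathfrak g}$; $\mathrm{Der}(\mathfrak g)$ is the Lie algebra of derivations. $\langle\cdot,\cdot\rangle$ is the pairing $\mathfrak h^*\times\mathfrak h\to\mathbb K$. An expression with a dot denotes an element of $\mathfrak h^*$: e.g. $\Omega(X)(Y,\cdot)$ is $Z\mapsto\Omega(X)(Y,Z)$, and $\omega_{\mathfrak g}(K(\cdot)a,b)$ is $Z\mapsto\omega_{\mathfrak g}(K(Z)a,b)$. *)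

(* Defs.v *)
From HB Require Import structures.
From mathcomp Require Import all_boot all_order all_algebra.
From mathcomp Require Import ring_quotient generic_quotient sesquilinear.
From mathcomp Require Import ring.
Set Implicit Arguments.
Unset Strict Implicit.
Unset Printing Implicit Defensive.
Import GRing.Theory.
Local Open Scope ring_scope.
Local Open Scope quotient_scope.

Lemma linfunE (K : fieldType) (U V : vectType K) (f : U -> V) :
  linear f -> linfun f =1 f.
Proof.
move=> f_lin.
pose g : {linear U -> V} := HB.pack f (GRing.isLinear.Build K U V *:%R f f_lin).
exact: (lfunE g).
Qed.

(* The quotient V / U, on the carrier of equivalence classes provided by
   ring_quotient for the additive groups, made into a vector space. *)
Section QuotientSpace.
Variables (K : fieldType) (V : vectType K) (U : {vspace V}).

Definition quotv := @Quotient.quot V (pred_of_vspace U).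
HB.instance Definition _ := Choice.on quotv.
HB.instance Definition _ := EqQuotient.on quotv.
HB.instance Definition _ := GRing.Zmodule.on quotv.

Definition quot_pi (v : V) : quotv := \pi_quotv v.

Lemma quot_piE u v : (quot_pi u == quot_pi v) = (u - v \in U).
Proof. by rewrite /quot_pi piE. Qed.

Lemma quot_reprK (x : quotv) : quot_pi (repr x) = x.
Proof. exact: reprK. Qed.

Lemma quot_piD u v : quot_pi (u + v) = quot_pi u + quot_pi v.
Proof. exact: (@Quotient.pi_add V (pred_of_vspace U)). Qed.

Definition quot_scale (k : K) (x : quotv) : quotv := quot_pi (k *: repr x).

Lemma quot_piZ k v : quot_pi (k *: v) = quot_scale k (quot_pi v).
Proof.
apply/eqP; rewrite quot_piE -scalerBr memvZ // -quot_piE.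
by rewrite quot_reprK.
Qed.

Fact quot_scaleA a b x : quot_scale a (quot_scale b x) = quot_scale (a * b) x.
Proof. by rewrite -[x]quot_reprK -!quot_piZ scalerA. Qed.

Fact quot_scale1 : left_id 1 quot_scale.
Proof. by move=> x; rewrite -[x]quot_reprK -!quot_piZ scale1r. Qed.

Fact quot_scaleDr : right_distributive quot_scale +%R.
Proof.
move=> a x y; rewrite -[x]quot_reprK -[y]quot_reprK.
by rewrite -quot_piD -!quot_piZ -quot_piD scalerDr.
Qed.

Fact quot_scaleDl x : {morph quot_scale^~ x : a b / a + b}.
Proof.
by move=> a b; rewrite /= -[x]quot_reprK -!quot_piZ -quot_piD scalerDl.
Qed.

HB.instance Definition _ := GRing.Zmodule_isLmodule.Build K quotv
  quot_scaleA quot_scale1 quot_scaleDr quot_scaleDl.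

Fact quot_pi_is_linear : linear quot_pi.
Proof. by move=> k u v; rewrite quot_piD quot_piZ. Qed.
HB.instance Definition _ :=
  GRing.isLinear.Build K V quotv *:%R quot_pi quot_pi_is_linear.

Lemma linear_quot_pi_repr (W : lmodType K) (f : {linear V -> W}) v :
  (forall u, u \in U -> f u = 0) -> f (repr (quot_pi v)) = f v.
Proof.
move=> f0; apply/eqP; rewrite -subr_eq0 -linearB f0 // -quot_piE.
by rewrite quot_reprK.
Qed.

Fact quotv_vect_iso : Vector.axiom (\dim (U^C)%VS) quotv.
Proof.
have capC : (U^C :&: U = 0)%VS by rewrite capvC capv_compl.
pose p : 'End(V) := daddv_pi (U^C) U.
have pU u : u \in U -> p u = 0.
  move=> uU; have := daddv_pi_add (capv_compl U) (w := u).
  rewrite addv_complf memvf daddv_pi_id ?capv_compl // => /(_ isT).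
  by rewrite -[RHS]addr0 => /addrI.
have pB v : v - p v \in U.
  have := daddv_pi_add (capv_compl U) (w := v).
  rewrite addv_complf memvf => /(_ isT) {1}<-.
  by rewrite addrK memv_pi.
pose f : 'Hom(V, subvs_of (U^C)%VS) := (linfun (vsproj (U^C)%VS) \o p)%VF.
have fE v : f v = vsproj (U^C)%VS (p v) by rewrite comp_lfunE lfunE.
have fU u : u \in U -> f u = 0 by move=> uU; rewrite fE pU // linear0.
have [g g_lin g_bij] := subvs_vect_iso (U^C)%VS.
exists (fun x => g (f (repr x))).
  move=> k x y; rewrite -[x]quot_reprK -[y]quot_reprK.
  rewrite -(linearP quot_pi) !linear_quot_pi_repr // linearP.
  exact: g_lin.
have [g' gK g'K] := g_bij.
exists (fun r => quot_pi (vsval (g' r))) => [x | r].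
  rewrite -[RHS]quot_reprK; apply/eqP; rewrite quot_piE /=.
  by rewrite gK fE vsprojK ?memv_pi // -memvN opprB pB.
by rewrite linear_quot_pi_repr //= fE daddv_pi_id ?subvsP // vsvalK.
Qed.

HB.instance Definition _ := Lmodule_hasFinDim.Build K quotv quotv_vect_iso.

Lemma quot_pi_eq0 v : (quot_pi v == 0) = (v \in U).
Proof. by rewrite -(linear0 quot_pi) quot_piE subr0. Qed.

(* A linear choice of representatives. *)
Definition quot_sec : 'Hom(quotv, V) := (linfun quot_pi)^-1%VF.

Lemma quot_secK x : quot_pi (quot_sec x) = x.
Proof.
rewrite -[LHS](lfunE quot_pi) limg_lfunVK // -[x]quot_reprK.
by rewrite -(lfunE quot_pi) memv_img ?memvf.
Qed.

Lemma quot_sec_pi v : quot_sec (quot_pi v) - v \in U.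
Proof. by rewrite -quot_piE quot_secK. Qed.

End QuotientSpace.

Section SkewForms.
Variables (K : fieldType) (V : vectType K) (om : {skew_symmetric V}).

Definition form_dual (v : V) : 'Hom(V, K^o) := linfun (applyr om v : V -> K^o).

Lemma form_dualE v u : form_dual v u = om u v.
Proof. by rewrite lfunE. Qed.

Fact form_dual_is_linear : linear form_dual.
Proof.
move=> k v w; apply/lfunP => u.
by rewrite add_lfunE scale_lfunE !form_dualE linearPr.
Qed.
HB.instance Definition _ :=
  GRing.isLinear.Build K V 'Hom(V, K^o) *:%R form_dual form_dual_is_linear.

(* The adjoint T^* of T, determined by om (T u) v = om u (T^* v) when om is
   nondegenerate: T^* v represents the linear form u |-> om (T u) v. *)
Definition adjoint (T : 'End(V)) : 'End(V) :=
  linfun (fun v => (linfun form_dual)^-1%VF (form_dual v \o T)%VF).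

Lemma adjoint_applyE T v :
  adjoint T v = (linfun form_dual)^-1%VF (form_dual v \o T)%VF.
Proof.
apply: linfunE => k {}v w.
by rewrite linearP comp_lfunDl -comp_lfunZl linearP.
Qed.

Lemma nondegenerate_eq0 u :
  nondegenerate om -> (forall v, om u v = 0) -> u = 0.
Proof.
move=> /eqP nd u0; apply/eqP; rewrite -memv0 -nd.
by apply/mem_orthovP => v _.
Qed.

Lemma nondegenerateP :
  nondegenerate om <-> (forall u, (forall v, om u v = 0) -> u = 0).
Proof.
split=> [nd u|nd]; first exact: nondegenerate_eq0.
rewrite /nondegenerate -subv0; apply/subvP => u /mem_orthovP u0.
by rewrite memv0 (nd u) // => v; rewrite u0 ?memvf.
Qed.

Lemma skewC u v : om u v = - om v u.
Proof. by rewrite hermC expr1 mulN1r. Qed.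

Lemma formBr u v w : om u (v - w) = om u v - om u w.
Proof. exact: linearBr. Qed.

Lemma form0l v : om 0 v = 0.
Proof. exact: linear0l. Qed.

Lemma formNr u v : om u (- v) = - om u v.
Proof. exact: linearNr. Qed.

Lemma formZr k u v : om u (k *: v) = k * om u v.
Proof. exact: linearZr_LR. Qed.

Lemma adjointP (T : 'End(V)) u v :
  nondegenerate om -> om (T u) v = om u (adjoint T v).
Proof.
move=> nd; rewrite adjoint_applyE -!form_dualE -[form_dual v _]comp_lfunE.
have kerD : lker (linfun form_dual) == 0%VS.
  apply/lker0P => x y; rewrite !lfunE => exy; apply/eqP.
  rewrite -subr_eq0; apply/eqP/(nondegenerate_eq0 nd) => w.
  by rewrite skewC -form_dualE linearB /= exy subrr lfunE oppr0.
have : limg (linfun form_dual) = fullv.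
  apply/eqP; rewrite eqEdim subvf limg_dim_eq ?(eqP kerD) ?capv0 //.
  by rewrite !dimvf -[X in (X <= _)%N]/(dim V * 1)%N muln1 leqnn.
move=> imD; rewrite -[in RHS](lfunE form_dual) limg_lfunVK ?imD ?memvf //.
Qed.

Fact adjoint_is_linear : linear adjoint.
Proof.
move=> k S T; apply/lfunP => v.
rewrite add_lfunE scale_lfunE !adjoint_applyE -linearP.
by rewrite comp_lfunDr -comp_lfunZr.
Qed.
HB.instance Definition _ :=
  GRing.isLinear.Build K 'End(V) 'End(V) *:%R adjoint adjoint_is_linear.

End SkewForms.

Section Algebras.
Variables (K : fieldType) (A : vectType K).
Variables (mul : {bilinear A -> A -> A}) (om : {skew_symmetric A}).

Definition lmul (u : A) : 'End(A) := linfun (mul u).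

Definition left_leibniz :=
  forall u v w, mul u (mul v w) = mul (mul u v) w + mul v (mul u w).

Definition symplectic_left_leibniz :=
  [/\ left_leibniz, nondegenerate om &
      forall u v, adjoint om (lmul v) u - adjoint om (lmul u) v
                  = 2^-1 *: (mul u v - mul v u)].

Definition lie_algebra :=
  (forall a, mul a a = 0) /\
  (forall a b c, mul a (mul b c) + mul b (mul c a) + mul c (mul a b) = 0).

Definition symplectic_lie :=
  [/\ lie_algebra, nondegenerate om &
      forall a b c, om (mul a b) c + om (mul b c) a + om (mul c a) b = 0].

Definition derivation (D : 'End(A)) :=
  forall a b, D (mul a b) = mul (D a) b + mul a (D b).

(* The left symmetric product a * b of a symplectic Lie algebra, and its right
   multiplications. *)
Definition lsym (a b : A) : A := - adjoint om (lmul a) b.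

Definition lsym_rmul (b : A) : 'End(A) := linfun (lsym^~ b).

Lemma mulDl u v w : mul (u + v) w = mul u w + mul v w.
Proof. exact: linearDl. Qed.

Lemma mulDr u v w : mul u (v + w) = mul u v + mul u w.
Proof. exact: linearDr. Qed.

Lemma lmulE u v : lmul u v = mul u v.
Proof. by rewrite lfunE. Qed.

Fact lmul_is_linear : linear lmul.
Proof.
move=> k u v; apply/lfunP => w.
by rewrite add_lfunE scale_lfunE !lmulE linearPl.
Qed.
HB.instance Definition _ :=
  GRing.isLinear.Build K A 'End(A) *:%R lmul lmul_is_linear.

Lemma lsym_rmulE a b : lsym_rmul b a = lsym a b.
Proof.
apply: linfunE => k u v; rewrite /lsym !linearP add_lfunE scale_lfunE.
by rewrite opprD scalerN.
Qed.

(* Leib(A); by bilinearity it is enough to let u and v range over a basis, see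
   leib_mem and leib_min. *)
Definition leib : {vspace A} :=
  <<[seq (mul u v + mul v u)%R | u <- vbasis {:A}, v <- vbasis {:A}]>>%VS.

Lemma leib_min (W : {vspace A}) :
  (forall u v, mul u v + mul v u \in W) -> (leib <= W)%VS.
Proof. by move=> symW; apply/span_subvP => _ /allpairsP[[u v] [_ _ ->]]. Qed.

Lemma leib_mem u v : mul u v + mul v u \in leib.
Proof.
pose f w : 'End(A) := lmul w + linfun (applyr mul w).
have fE w x : f w x = mul w x + mul x w by rewrite add_lfunE !lfunE.
have fB w : (forall x, x \in vbasis {:A} -> f w x \in leib) ->
    forall x, f w x \in leib.
  move=> fw x; rewrite (coord_vbasis (memvf x)) linear_sum.
  apply: rpred_sum => i _; rewrite linearZ; apply/rpredZ/fw.
  by apply: mem_nth; rewrite size_tuple.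
rewrite -fE; apply: (fB) => x xB; rewrite fE addrC -fE.
apply: (fB) => y yB; rewrite fE memv_span //.
by apply: (allpairs_f (fun u v => mul u v + mul v u)).
Qed.

(* The isotropic ideal I, its orthogonal, and the two components of the core:
   g = I^perp / I and h = A / I^perp. *)
Definition core_ideal : {vspace A} := (leib :&: orthov om leib)%VS.
Definition core_perp : {vspace A} := orthov om core_ideal.

Definition core_g : vectType K :=
  quotv (linfun (vsval : subvs_of core_perp -> A) @^-1: core_ideal)%VS.
Definition core_h : vectType K := quotv core_perp.

Definition core_lift (x : core_g) : A := vsval (quot_sec _ x).
Definition core_proj (u : A) : core_g := quot_pi _ (vsproj core_perp u).

(* The induced product and form are computed on representatives; they do not
   depend on the choice of these, see core_brE and core_formE. *)
Definition core_br (x y : core_g) : core_g :=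
  core_proj (mul (core_lift x) (core_lift y)).
Definition core_form (x y : core_g) : K := om (core_lift x) (core_lift y).

Fact core_br_is_bilinear : bilinear_for *:%R *:%R core_br.
Proof.
split=> [y k x x'|x k y y']; rewrite /core_br /core_lift /core_proj !linearP //.
by rewrite linearPl !linearP.
Qed.
HB.instance Definition _ :=
  bilinear_isBilinear.Build K core_g core_g core_g *:%R *:%R core_br
    core_br_is_bilinear.

Fact core_form_is_bilinear : bilinear_for *%R (idfun \; *%R) core_form.
Proof.
split=> [y k x x'|x k y y']; rewrite /core_form /core_lift !linearP //.
by rewrite linearPl.
Qed.
HB.instance Definition _ :=
  bilinear_isBilinear.Build K core_g core_g K *%R (idfun \; *%R) core_form
    core_form_is_bilinear.
Fact core_form_is_skew x y :
  core_form x y = (-1) ^+ true * idfun (core_form y x).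
Proof. exact: hermC. Qed.
HB.instance Definition _ :=
  isHermitianSesquilinear.Build K core_g true idfun core_form core_form_is_skew.

Lemma core_idealP u :
  reflect (u \in leib /\ forall v, v \in leib -> om u v = 0)
          (u \in core_ideal).
Proof.
rewrite memv_cap; apply: (iffP andP) => -[uL uO]; split => //.
  by move=> v; apply/mem_orthovP.
exact/mem_orthovP.
Qed.

Lemma core_perpP u :
  reflect (forall v, v \in core_ideal -> om u v = 0) (u \in core_perp).
Proof. exact: mem_orthovP. Qed.

Lemma core_ideal_perp : (core_ideal <= core_perp)%VS.
Proof.
apply/subvP => u /core_idealP[_ uO]; apply/core_perpP => v /core_idealP[vL _].
exact: uO.
Qed.

Lemma core_proj_eq u v : u \in core_perp -> v \in core_perp ->
  (core_proj u == core_proj v) = (u - v \in core_ideal).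
Proof.
move=> uP vP; rewrite quot_piE -memv_preim linearB /= !lfunE /=.
by rewrite !vsprojK.
Qed.

Lemma core_lift_perp x : core_lift x \in core_perp.
Proof. exact: subvsP. Qed.

Lemma core_liftK x : core_proj (core_lift x) = x.
Proof. by rewrite /core_proj /core_lift vsvalK quot_secK. Qed.

Lemma core_lift_proj u :
  u \in core_perp -> core_lift (core_proj u) - u \in core_ideal.
Proof.
by move=> uP; rewrite -core_proj_eq ?core_lift_perp // core_liftK.
Qed.

Lemma core_formE u v : u \in core_perp -> v \in core_perp ->
  core_form (core_proj u) (core_proj v) = om u v.
Proof.
move=> uP vP; rewrite /core_form.
have := core_lift_proj vP; have := core_lift_proj uP.
have := core_lift_perp (core_proj u).
move: (core_lift (core_proj u)) (core_lift (core_proj v)) => x y xP xI yI.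
have xE : om x y = om x v.
  by apply/eqP; rewrite -subr_eq0 -formBr (core_perpP _ xP).
rewrite xE skewC [RHS]skewC; congr (- _); apply/eqP.
by rewrite -subr_eq0 -formBr (core_perpP _ vP).
Qed.

Section CoreProduct.
Hypotheses (char0 : [pchar K] =i pred0) (sympA : symplectic_left_leibniz).

Lemma leib_mull l v : l \in leib -> mul l v = 0.
Proof.
case: sympA => leibnizA _ _ lL.
suff /subvP/(_ l lL) : (leib <= lker (linfun (lmul : A -> 'End(A))))%VS.
  by rewrite memv_ker lfunE => /eqP/lfunP/(_ v); rewrite lmulE lfunE.
apply: leib_min => x y; rewrite memv_ker lfunE; apply/eqP/lfunP => w.
rewrite lmulE lfunE /= mulDl; have e := leibnizA x y w.
rewrite (leibnizA y x w) addrA in e.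
by apply: (addIr (mul x (mul y w))); rewrite add0r -e.
Qed.

Lemma leib_mulr u l : l \in leib -> mul u l \in leib.
Proof.
case: sympA => leibnizA _ _ lL.
suff /subvP/(_ l lL) : (leib <= lmul u @^-1: leib)%VS.
  by rewrite -memv_preim lmulE.
apply: leib_min => x y; rewrite -memv_preim lmulE mulDr.
rewrite (leibnizA u x y) (leibnizA u y x).
rewrite [X in _ + X]addrC addrACA; apply: rpredD; last exact: leib_mem.
exact: leib_mem.
Qed.

Lemma symplectic_leibE u v w :
  om (mul v w) u - om (mul u w) v = 2^-1 * om w (mul u v - mul v u).
Proof.
case: sympA => _ nd symA.
rewrite -(lmulE v) -(lmulE u w) !(adjointP _ _ _ nd) -formBr symA.
by rewrite formZr.
Qed.

Let nz2 : 2 != 0 :> K.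
Proof. by rewrite ((pcharf0P K).1 char0 2). Qed.

Lemma leib_formE u v w :
  u \in leib -> om (mul v w) u = - 2^-1 * om w (mul v u).
Proof.
move=> uL; have := symplectic_leibE u v w.
by rewrite !(leib_mull _ uL) sub0r form0l subr0 formNr mulrN mulNr.
Qed.

Lemma leib_form_comm u v w :
  w \in leib -> om w (mul u v) = om w (mul v u).
Proof.
move=> wL; have wE x y : om (mul x y) w = - 2^-1 * om y (mul x w).
  exact: leib_formE.
have dbl x y : om (mul x w) y = - 2 * om w (mul x y).
  rewrite skewC [in RHS]skewC wE mulrN mulNr mulNr mulrN opprK mulrA.
  by rewrite mulfV // mul1r.
have := symplectic_leibE u v w; rewrite !dbl formBr.
set a := om w (mul u v); set b := om w (mul v u) => e.
have {}e : 3 * (a - b) = 0.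
  have := congr1 ( *%R 2) e; rewrite mulrA mulfV // mul1r => {}e.
  have -> : 3 * (a - b) = 2 * (- 2 * b - - 2 * a) - (a - b) by ring.
  by rewrite e subrr.
apply/eqP; rewrite -subr_eq0; move/eqP: e.
by rewrite mulf_eq0 ((pcharf0P K).1 char0 3).
Qed.

Lemma core_ideal_mull i v : i \in core_ideal -> mul i v = 0.
Proof. by case/core_idealP=> iL _; apply: leib_mull. Qed.

Lemma core_ideal_mulr v i : i \in core_ideal -> mul v i \in core_ideal.
Proof.
case/core_idealP=> iL iO; apply/core_idealP; split; first exact: leib_mulr.
by move=> l lL; rewrite leib_formE // iO ?leib_mulr // mulr0.
Qed.

Lemma core_perp_mulr v w : w \in core_perp -> mul v w \in core_perp.
Proof.
move=> /core_perpP wP; apply/core_perpP => i iI.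
have [iL _] := core_idealP _ iI.
by rewrite leib_formE // wP ?core_ideal_mulr // mulr0.
Qed.

Lemma core_perp_mull v w : w \in core_perp -> mul w v \in core_perp.
Proof.
move=> wP; apply/core_perpP => i iI; have [iL _] := core_idealP _ iI.
rewrite skewC leib_form_comm // -skewC.
by rewrite (core_perpP _ (core_perp_mulr v wP)).
Qed.

Lemma core_brE u v : u \in core_perp -> v \in core_perp ->
  core_br (core_proj u) (core_proj v) = core_proj (mul u v).
Proof.
move=> uP vP; apply/eqP.
rewrite core_proj_eq ?core_perp_mulr ?core_lift_perp //.
have := core_lift_proj vP; have := core_lift_proj uP.
move: (core_lift (core_proj u)) (core_lift (core_proj v)) => x y xI yI.
rewrite -[x](subrK u) mulDl core_ideal_mull // add0r.
by rewrite -linearBr core_ideal_mulr.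
Qed.

End CoreProduct.

End Algebras.

Arguments core_br {K A} mul om x y.
Arguments core_form {K A} mul om x y.

Definition symplectic_isomorphic (K : fieldType) (A B : vectType K)
    (mulA : {bilinear A -> A -> A}) (omA : {skew_symmetric A})
    (mulB : {bilinear B -> B -> B}) (omB : {skew_symmetric B}) :=
  exists phi : 'Hom(A, B),
    [/\ bijective phi, {morph phi : u v / mulA u v >-> mulB u v} &
        isometry omB omA phi].

(* The data F, G, Omega, theta, psi, xi on a pair g, h. The dual h^* is
   'Hom(h, K^o), and h^* (x) h^* is the space of bilinear forms on h, curried:
   Omega X Y : h^* is Omega(X)(Y, .). *)
Section Model.
Variables (K : fieldType) (g h : vectType K).
Variables (br : {bilinear g -> g -> g}) (og : {skew_symmetric g}).
Variables (F G : 'Hom(h, 'End(g))).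
Variable (Omega : 'Hom(h, 'Hom(h, 'Hom(h, K^o)))).
Variables (theta psi xi : {bilinear h -> h -> g}).

Definition mapS (X : h) : 'End(g) := F X + G X.
Definition mapK (X : h) : 'End(g) := 2^-1 *: mapS X - F X - adjoint og (F X).

Definition model : vectType K := (h * g * 'Hom(h, K^o))%type.

(* Z |-> og (mapK Z a) b and Z |-> og (tau X Z) a, as elements of h^*; see
   mapK_formE and dual_formE. *)
Definition mapK_form (a b : g) : 'Hom(h, K^o) :=
  linfun (fun Z => og (mapK Z a) b : K^o).
Definition dual_form (tau : {bilinear h -> h -> g}) (X : h) (a : g) :
    'Hom(h, K^o) :=
  linfun (fun Z => og (tau X Z) a : K^o).

Definition model_mul (u v : model) : model :=
  let: (X, a, _) := u in
  let: (Y, b, _) := v in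
  (0,
   theta X Y + br a b + F X b + G Y a,
   Omega X Y + mapK_form a b + dual_form psi X b + dual_form xi Y a).

Definition model_form (u v : model) : K :=
  let: (X, a, alpha) := u in
  let: (Y, b, beta) := v in
  alpha Y - beta X + og a b.

Let combD (W : lmodType K) (k : K) (x x' y y' : W) :
  (k *: x + x') + (k *: y + y') = k *: (x + y) + (x' + y').
Proof. by rewrite scalerDr addrACA. Qed.

Let combB (W : lmodType K) (k : K) (x x' y y' : W) :
  (k *: x + x') - (k *: y + y') = k *: (x - y) + (x' - y').
Proof. by rewrite scalerBr opprD addrACA. Qed.

Lemma mapK_linear a : linear (fun Z => mapK Z a).
Proof.
move=> k X Y; rewrite /mapK /mapS !lfun_simp !linearP /= !lfun_simp.
move: (F X a) (F Y a) (G X a) (G Y a) (adjoint og (F X) a) (adjoint og (F Y) a).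
move=> x x' y y' z z'; rewrite combD (scalerDr 2^-1 (k *: _)) scalerA mulrC.
by rewrite -scalerA !combB.
Qed.

Lemma mapK_formE a b Z : mapK_form a b Z = og (mapK Z a) b.
Proof.
by rewrite /mapK_form linfunE // => k X Y; rewrite mapK_linear linearPl.
Qed.

Lemma dual_formE tau X a Z : dual_form tau X a Z = og (tau X Z) a.
Proof.
by rewrite /dual_form linfunE // => k Y Y'; rewrite linearPr linearPl.
Qed.

Fact model_mul_is_bilinear : bilinear_for *:%R *:%R model_mul.
Proof.
split=> [[[Y b] beta] k [[X a] alpha] [[X' a'] alpha'] |
         [[Y b] beta] k [[X a] alpha] [[X' a'] alpha']].
  congr (_, _, _) => /=; first by rewrite scaler0 addr0.
    by rewrite !linearPl !linearP add_lfunE scale_lfunE !combD.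
  rewrite linearP add_lfunE scale_lfunE.
  have -> : mapK_form (k *: a + a') b = k *: mapK_form a b + mapK_form a' b.
    apply/lfunP => Z; rewrite add_lfunE scale_lfunE !mapK_formE.
    by rewrite linearP linearPl.
  have -> : dual_form psi (k *: X + X') b
          = k *: dual_form psi X b + dual_form psi X' b.
    apply/lfunP => Z; rewrite add_lfunE scale_lfunE !dual_formE.
    by rewrite !linearPl.
  have -> : dual_form xi Y (k *: a + a')
          = k *: dual_form xi Y a + dual_form xi Y a'.
    apply/lfunP => Z; rewrite add_lfunE scale_lfunE !dual_formE.
    by rewrite linearPr.
  by rewrite !combD.
congr (_, _, _) => /=; first by rewrite scaler0 addr0.
  by rewrite !linearP add_lfunE scale_lfunE !combD.
rewrite linearP.
have -> : mapK_form b (k *: a + a') = k *: mapK_form b a + mapK_form b a'.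
  apply/lfunP => Z; rewrite add_lfunE scale_lfunE !mapK_formE.
  by rewrite linearPr.
have -> : dual_form psi Y (k *: a + a')
        = k *: dual_form psi Y a + dual_form psi Y a'.
  apply/lfunP => Z; rewrite add_lfunE scale_lfunE !dual_formE.
  by rewrite linearPr.
have -> : dual_form xi (k *: X + X') b
        = k *: dual_form xi X b + dual_form xi X' b.
  apply/lfunP => Z; rewrite add_lfunE scale_lfunE !dual_formE.
  by rewrite !linearPl.
by rewrite !combD.
Qed.
HB.instance Definition _ :=
  bilinear_isBilinear.Build K model model model *:%R *:%R model_mul
    model_mul_is_bilinear.

Fact model_form_is_skew u v :
  model_form u v = (-1) ^+ true * idfun (model_form v u).
Proof.
case: u v => [[X a] alpha] [[Y b] beta] /=.
by rewrite skewC mulN1r opprD opprB.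
Qed.

Fact model_form_is_bilinear : bilinear_for *%R (idfun \; *%R) model_form.
Proof.
have formP v : GRing.linear_for *%R (model_form^~ v).
  case: v => [[Y b] beta] k [[X a] alpha] [[X' a'] alpha'] /=.
  rewrite linearPl linearP add_lfunE scale_lfunE.
  rewrite (combB (W := K^o)) (combD (W := K^o)) //.
split=> // u k v w; rewrite !(model_form_is_skew u) expr1 !mulN1r.
by have /= -> := formP u k v w; rewrite opprD mulrN.
Qed.
HB.instance Definition _ :=
  bilinear_isBilinear.Build K model model K *%R (idfun \; *%R) model_form
    model_form_is_bilinear.
HB.instance Definition _ :=
  isHermitianSesquilinear.Build K model true idfun model_form
    model_form_is_skew.

Local Notation adj := (adjoint og).

Definition structure_equations : Prop :=
  (forall X Y Z : h, Omega X Z Y - Omega Y Z X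
     = 2^-1 * Omega X Y Z - 2^-1 * Omega Y X Z) /\
  (forall X Y, psi X Y - psi Y X = xi Y X - xi X Y) /\
  (forall X Y,
     theta X Y = xi Y X + 2^-1 *: psi X Y - 2^-1 *: xi X Y) /\
  (forall X Y Z T, og (theta X Y) (xi Z T) - og (theta Y Z) (psi X T)
     + og (theta X Z) (psi Y T) = 0) /\
  (forall X Y Z, F X (theta Y Z) - F Y (theta X Z) + F Z (theta X Y)
     = mapS Z (theta X Y)) /\
  (forall X Y Z,
     adj (F X) (psi Y Z) - adj (F Y) (psi X Z) + mapK Z (theta X Y) = 0) /\
  (forall X Y Z, adj (F X) (psi Y Z + xi Y Z) + mapS Y (psi X Z)
     + mapS Z (theta X Y) = 0) /\
  (forall X Y, lmul br (theta X Y) = (F X \o F Y)%VF - (F Y \o F X)%VF) /\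
  (forall X Y, lsym_rmul br og (psi X Y)
     = ((F Y + adj (F Y)) \o F X)%VF + (adj (F X) \o (F Y + adj (F Y)))%VF) /\
  (forall X Y, lsym_rmul br og (psi X Y + xi X Y) = 0) /\
  (forall X a b, mapS X (lsym br og a b) = 0) /\
  (forall X, adj (mapS X) = - mapS X) /\
  (forall X Y Z, mapS X (xi Y Z) = 0) /\
  (forall X Y, [/\ (mapS X \o mapS Y)%VF = 0, (F X \o mapS Y)%VF = 0 &
                  (mapS X \o F Y)%VF = 0]).

End Model.

Arguments model_form {K g} h og u v.

(* Main.v *)
(* Pairing the defining identities of a symplectic left Leibniz algebra on the
   model h + g + h^* with pure vectors splits them into scalar components, and
   the structure equations are a rearrangement of these components.  The
   converse direction is this rearrangement.

   For the direct one, om (u v) i = 0 for i in I because om i (u v) is symmetric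
   in u, v and i is orthogonal to Leib(A).  Hence A.A lies in I^perp and A.I = 0;
   likewise A.Leib(A) lies in I.  A section s of A -> h can be corrected by
   elements of I = h^* into an isotropic one, and a lift t of g into I^perp so
   that its image is orthogonal to s(h).  In the decomposition
   A = s(h) + t(g) + I the form is the model form, and the product has the shape
   of the model, K being forced by the symplectic identity.  The structure
   equations then follow from the component identities, the bracket of g being
   alternating, and F(X) S(Y) = 0, which expresses that A.Leib(A) <= I. *)

Require Import Defs.
From HB Require Import structures.
From mathcomp Require Import all_boot all_order all_algebra.
From mathcomp Require Import sesquilinear.
From mathcomp Require Import ring.
Set Implicit Arguments.
Unset Strict Implicit.
Unset Printing Implicit Defensive.
Import GRing.Theory.
Local Open Scope ring_scope.

(** Reduces a scalar identity to a known one: the second premise is closed by [ring] or [field] once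
    the right multiple of the known identity is supplied. *)
Lemma linear_combination (R : pzRingType) (x y u v : R) :
  u = v -> (x - y) - (u - v) = 0 -> x = y.
Proof. by move=> ->; rewrite subrr subr0 => /subr0_eq. Qed.

(** * Calculus of nondegenerate skew forms *)

Section Forms.
Variables (K : fieldType) (V : vectType K) (om : {skew_symmetric V}).
Hypothesis nd : nondegenerate om.

Lemma formDl u v w : om (u + v) w = om u w + om v w.
Proof. exact: linearDl. Qed.

Lemma formDr u v w : om u (v + w) = om u v + om u w.
Proof. exact: linearDr. Qed.

Lemma formNl u v : om (- u) v = - om u v.
Proof. exact: linearNl. Qed.

Lemma formZl k u v : om (k *: u) v = k * om u v.
Proof. exact: linearZl_LR. Qed.

Lemma form0r v : om v 0 = 0.
Proof. exact: linear0r. Qed.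

Lemma formBl u v w : om (u - v) w = om u w - om v w.
Proof. exact: linearBl. Qed.

Definition formE := (formDl, formDr, formNl, Defs.formNr, formZl, Defs.formZr).

Lemma adjointPl T u v : om (adjoint om T u) v = om u (T v).
Proof. by rewrite skewC -adjointP // skewC opprK. Qed.

Lemma form_inj u v : (forall w, om u w = om v w) -> u = v.
Proof.
move=> uv; apply: subr0_eq; apply: (nondegenerate_eq0 nd) => w.
by rewrite formDl formNl uv subrr.
Qed.

Lemma lfun_form_inj (S T : 'End(V)) :
  (forall u v, om (S u) v = om (T u) v) -> S = T.
Proof. by move=> ST; apply/lfunP => u; apply: form_inj => v. Qed.
End Forms.

(** Pairing the symplectic condition with an arbitrary [w] moves the adjoints to the other side of
    [om]; nondegeneracy allows the way back. *)
Lemma symplectic_left_leibnizP (K : fieldType) (A : vectType K)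
    (mul : {bilinear A -> A -> A}) (om : {skew_symmetric A}) :
  symplectic_left_leibniz mul om <->
  [/\ left_leibniz mul, nondegenerate om & forall u v w,
      om (mul v w) u - om (mul u w) v = 2^-1 * om w (mul u v - mul v u)].
Proof.
split=> [sympA|[leibnizA nd symA]].
  by split=> [||u v w]; [case: sympA..|exact: (symplectic_leibE sympA)].
split=> // u v; apply: (form_inj nd) => w.
rewrite !formE /= !(adjointPl nd) !lmulE.
have := symA u v w; rewrite !formE => e.
rewrite (skewC om u) (skewC om v) (skewC om _ w) (skewC om (mul v u)).
by apply: (linear_combination (esym e)); ring.
Qed.

(* Proves an equation of vectors of a nondegenerate space by pairing it with an
   arbitrary vector and subtracting the vector equation e, up to ring. *)
Ltac pair_combination nd om e := apply: (form_inj nd) => w;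
  have := congr1 (om^~ w) e;
  rewrite /= !(formDl om, formNl om, Defs.form0l om) => {}e;
  apply: (linear_combination e).

(** * Scalar components of the model identities *)

Section Model.
Variables (K : fieldType) (g h : vectType K).
Variables (br : {bilinear g -> g -> g}) (og : {skew_symmetric g}).
Variables (F G : 'Hom(h, 'End(g))).
Variable (Omega : 'Hom(h, 'Hom(h, 'Hom(h, K^o)))).
Variables (theta psi xi : {bilinear h -> h -> g}).

Local Notation S := (mapS F G).
Local Notation k Z a b := (og (Defs.mapK og F G Z a) b).
Local Notation mmul := (model_mul br og F G Omega theta psi xi).
Local Notation mform := (model_form h og).

(* Field suffixes give the component of each argument (h or g) and, in the
   prefix, the component of the value: lg in g, ls in h^*. *)
Record leibniz_components : Prop := LeibnizComponents {
  lg_hhh X Y Z : F X (theta Y Z) = G Z (theta X Y) + F Y (theta X Z);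
  lg_hhg X Y c : F X (F Y c) = br (theta X Y) c + F Y (F X c);
  lg_hgh X b Z : F X (G Z b) = G Z (F X b) + br b (theta X Z);
  lg_ghh a Y Z : br a (theta Y Z) = G Z (G Y a) + F Y (G Z a);
  lg_hgg X b c : F X (br b c) = br (F X b) c + br b (F X c);
  lg_ghg a Y c : br a (F Y c) = br (G Y a) c + F Y (br a c);
  lg_ggh a b Z : br a (G Z b) = G Z (br a b) + br b (G Z a);
  lg_ggg a b c : br a (br b c) = br (br a b) c + br b (br a c);
  ls_hhh X Y Z T : og (psi X T) (theta Y Z) =
    og (xi Z T) (theta X Y) + og (psi Y T) (theta X Z);
  ls_hhg X Y c T : og (psi X T) (F Y c) =
    k T (theta X Y) c + og (psi Y T) (F X c);
  ls_hgh X b Z T : og (psi X T) (G Z b) =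
    og (xi Z T) (F X b) + k T b (theta X Z);
  ls_ghh a Y Z T : k T a (theta Y Z) =
    og (xi Z T) (G Y a) + og (psi Y T) (G Z a);
  ls_hgg X b c T : og (psi X T) (br b c) = k T (F X b) c + k T b (F X c);
  ls_ghg a Y c T : k T a (F Y c) = k T (G Y a) c + og (psi Y T) (br a c);
  ls_ggh a b Z T : k T a (G Z b) = og (xi Z T) (br a b) + k T b (G Z a);
  ls_ggg a b c T : k T a (br b c) = k T (br a b) c + k T b (br a c) }.

(** Six of the eight types suffice: the identity is antisymmetric in its first two arguments, so
    [ghh] and [ghg] are the negatives of [hgh] and [hgg]. *)
Record symplectic_components : Prop := SymplecticComponents {
  sy_hhh X Y Z : Omega Y Z X - Omega X Z Y =
    - 2^-1 * (Omega X Y Z - Omega Y X Z);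
  sy_hhg X Y c : og (psi Y X) c - og (psi X Y) c =
    - 2^-1 * (og (theta X Y) c - og (theta Y X) c);
  sy_hgh X b Z : og (xi Z X) b - og (theta X Z) b =
    - 2^-1 * (og (psi X Z) b - og (xi X Z) b);
  sy_hgg X b c : k X b c - og (F X c) b =
    2^-1 * (og c (F X b) - og c (G X b));
  sy_ggh a b Z : og (G Z b) a - og (G Z a) b =
    - 2^-1 * (k Z a b - k Z b a);
  sy_ggg a b c : og (br b c) a - og (br a c) b =
    2^-1 * (og c (br a b) - og c (br b a)) }.

Hypothesis nd : nondegenerate og.

Let bil0l (U V W : lmodType K) (f : {bilinear U -> V -> W}) v : f 0 v = 0.
Proof. exact: linear0l. Qed.

Let bil0r (U V W : lmodType K) (f : {bilinear U -> V -> W}) v : f v 0 = 0.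
Proof. exact: linear0r. Qed.

Let hom0 (U V : vectType K) (f : 'Hom(U, V)) : f 0 = 0.
Proof. exact: linear0. Qed.

Lemma mapK0 : Defs.mapK og F G 0 = 0.
Proof.
rewrite /Defs.mapK /mapS (hom0 F) (hom0 G) addr0 scaler0.
by rewrite (linear0 (adjoint og)) !subr0.
Qed.

Let zE := (bil0l br, bil0r br, bil0l theta, bil0r theta, bil0l psi, bil0r psi,
  bil0l xi, bil0r xi, hom0 F, hom0 G, hom0 Omega,
  (fun X => hom0 (F X)), (fun X => hom0 (G X)), (fun X => hom0 (Omega X)),
  (fun X => hom0 (Defs.mapK og F G X)),
  Defs.form0l og, form0r og, mapK0, zero_lfunE, addr0, add0r).

Let mul_g (u v : model g h) := theta u.1.1 v.1.1 + br u.1.2 v.1.2 +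
  F u.1.1 v.1.2 + G v.1.1 u.1.2.
Let mul_s (u v : model g h) T := Omega u.1.1 v.1.1 T + k T u.1.2 v.1.2 +
  og (psi u.1.1 T) v.1.2 + og (xi v.1.1 T) u.1.2.

Let mul_gE u v : (mmul u v).1 = (0, mul_g u v).
Proof. by case: u v => [[X a] x] [[Y b] y]. Qed.

Let mul_sE u v T : (mmul u v).2 T = mul_s u v T.
Proof.
case: u v => [[X a] x] [[Y b] y].
by rewrite /= !add_lfunE mapK_formE !dual_formE.
Qed.

Let model_ext (u v : model g h) : u.1 = v.1 -> u.2 = v.2 -> u = v.
Proof. by case: u v => [u1 u2] [v1 v2] /= -> ->. Qed.

(** Every product has zero [h] component, and the [h^*] components of the factors are annihilated.
    Hence an inner product enters the outer one only through its [g] component [p], [q] or [r]. *)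
Let leibnizP : left_leibniz mmul <->
  (forall X a Y b Z c,
    let p := theta X Y + br a b + F X b + G Y a in
    let q := theta Y Z + br b c + F Y c + G Z b in
    let r := theta X Z + br a c + F X c + G Z a in
    (br a q + F X q = br p c + G Z p + (br b r + F Y r)) /\
    forall T, k T a q + og (psi X T) q =
      k T p c + og (xi Z T) p + (k T b r + og (psi Y T) r)).
Proof.
split=> [leib X a Y b Z c p q r|comp [[X a] x] [[Y b] y] [[Z c] z]].
  have e := leib (X, a, 0) (Y, b, 0) (Z, c, 0); split=> [|T].
    by have := congr1 (fun u : model g h => u.1.2) e; rewrite /= !zE.
  have := congr1 (fun u : model g h => u.2 T) e.
  by rewrite (add_lfunE (mmul _ _).2) !mul_sE /mul_s !mul_gE /mul_g /= !zE.
have [gE sE] := comp X a Y b Z c.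
set u : model g h := (X, a, x); set v : model g h := (Y, b, y).
set w : model g h := (Z, c, z); apply: model_ext.
  rewrite -[LHS]/((mmul u (mmul v w)).1).
  rewrite -[RHS]/((mmul (mmul u v) w).1 + (mmul v (mmul u w)).1).
  rewrite !mul_gE /mul_g !mul_gE /=; congr (_, _); first by rewrite addr0.
  by rewrite !zE; apply: gE.
apply/lfunP => T.
by rewrite (add_lfunE (mmul _ _).2) !mul_sE /mul_s !mul_gE /mul_g /= !zE sE.
Qed.

(** The identity is trilinear: zero arguments isolate one type at a time, and the sum over all types
    restores it. *)
Lemma model_leibnizP : left_leibniz mmul <-> leibniz_components.
Proof.
rewrite leibnizP; split=> [leib|c X a Y b Z d p q r].
  split.
  - by move=> X Y Z; have [+ _] := leib X 0 Y 0 Z 0; rewrite /= !zE.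
  - by move=> X Y c; have [+ _] := leib X 0 Y 0 0 c; rewrite /= !zE.
  - by move=> X b Z; have [+ _] := leib X 0 0 b Z 0; rewrite /= !zE.
  - by move=> a Y Z; have [+ _] := leib 0 a Y 0 Z 0; rewrite /= !zE.
  - by move=> X b c; have [+ _] := leib X 0 0 b 0 c; rewrite /= !zE.
  - by move=> a Y c; have [+ _] := leib 0 a Y 0 0 c; rewrite /= !zE.
  - by move=> a b Z; have [+ _] := leib 0 a 0 b Z 0; rewrite /= !zE.
  - by move=> a b c; have [+ _] := leib 0 a 0 b 0 c; rewrite /= !zE.
  - by move=> X Y Z T; have [_ /(_ T)] := leib X 0 Y 0 Z 0; rewrite /= !zE.
  - by move=> X Y c T; have [_ /(_ T)] := leib X 0 Y 0 0 c; rewrite /= !zE.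
  - by move=> X b Z T; have [_ /(_ T)] := leib X 0 0 b Z 0; rewrite /= !zE.
  - by move=> a Y Z T; have [_ /(_ T)] := leib 0 a Y 0 Z 0; rewrite /= !zE.
  - by move=> X b c T; have [_ /(_ T)] := leib X 0 0 b 0 c; rewrite /= !zE.
  - by move=> a Y c T; have [_ /(_ T)] := leib 0 a Y 0 0 c; rewrite /= !zE.
  - by move=> a b Z T; have [_ /(_ T)] := leib 0 a 0 b Z 0; rewrite /= !zE.
  - by move=> a b c T; have [_ /(_ T)] := leib 0 a 0 b 0 c; rewrite /= !zE.
rewrite /p /q /r; split=> [|T].
  rewrite !(mulDl, mulDr) !(linearD (F _)) !(linearD (G _)) /=.
  rewrite (lg_ghh c a) (lg_ggg c a) (lg_ghg c a) (lg_ggh c a).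
  rewrite (lg_hhh c X) (lg_hgg c X) (lg_hhg c X) (lg_hgh c X).
  by apply: (form_inj nd) => w; rewrite !formDl; ring.
have kDl u v w : k T (u + v) w = k T u w + k T v w by rewrite linearD /= formDl.
rewrite !(formDr, kDl) (ls_hhh c) (ls_hhg c) (ls_hgh c) (ls_ghh c).
by rewrite (ls_hgg c) (ls_ghg c) (ls_ggh c) (ls_ggg c); ring.
Qed.

Let form_split (u v : model g h) :
  mform u v = u.2 v.1.1 - v.2 u.1.1 + og u.1.2 v.1.2.
Proof. by case: u v => [[X a] x] [[Y b] y]. Qed.

Let symplecticP :
  (forall u v w, mform (mmul v w) u - mform (mmul u w) v
    = 2^-1 * mform w (mmul u v - mmul v u)) <->
  (forall X a Y b Z c,
     (mul_s (Y, b, 0) (Z, c, 0) X + og (mul_g (Y, b, 0) (Z, c, 0)) a)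
     - (mul_s (X, a, 0) (Z, c, 0) Y + og (mul_g (X, a, 0) (Z, c, 0)) b)
     = 2^-1 * (og c (mul_g (X, a, 0) (Y, b, 0) - mul_g (Y, b, 0) (X, a, 0))
         - (mul_s (X, a, 0) (Y, b, 0) Z - mul_s (Y, b, 0) (X, a, 0) Z))).
Proof.
have formM (u v w : model g h) :
    mform (mmul u v) w = mul_s u v w.1.1 + og (mul_g u v) w.1.2.
  by rewrite form_split mul_sE mul_gE /= linear0 subr0.
have formMr (u v w : model g h) :
    mform w (mmul u v - mmul v u) = og w.1.2 (mul_g u v - mul_g v u)
      - (mul_s u v w.1.1 - mul_s v u w.1.1).
  have mC x y : mform x y = - mform y x := skewC mform x y.
  have -> : mform w (mmul u v - mmul v u)
    = mform w (mmul u v) - mform w (mmul v u) := Defs.formBr mform w _ _.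
  rewrite !(mC w) !formM.
  rewrite (Defs.formBr og) (skewC og w.1.2) (skewC og w.1.2 (mul_g v u)).
  by ring.
split=> [sy X a Y b Z c|sy [[X a] x] [[Y b] y] [[Z c] z]].
  by have := sy (X, a, 0) (Y, b, 0) (Z, c, 0); rewrite formMr !formM.
by rewrite formMr !formM; apply: sy.
Qed.

Lemma model_symplecticP :
  (forall u v w, mform (mmul v w) u - mform (mmul u w) v
    = 2^-1 * mform w (mmul u v - mmul v u)) <-> symplectic_components.
Proof.
rewrite symplecticP; split=> [sy|c X a Y b Z d]; last first.
  rewrite /mul_s /mul_g /= !formE.
  (* [e1] adds up the six recorded types; [e2] is what the types [ghh] and [ghg] give after
     exchanging the first two arguments, so it is subtracted. *)
  have e1 := congr2 +%R
    (congr2 +%R (congr2 +%R (sy_hhh c X Y Z) (sy_hhg c X Y d))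
                (congr2 +%R (sy_hgh c X b Z) (sy_hgg c X b d)))
    (congr2 +%R (sy_ggh c a b Z) (sy_ggg c a b d)).
  have e2 := congr2 +%R (sy_hgh c Y a Z) (sy_hgg c Y a d).
  have := congr2 (fun x y => x - y) e1 e2.
  by rewrite !(skewC og d) => e; apply: (linear_combination e); ring.
split.
- move=> X Y Z; have := sy X 0 Y 0 Z 0.
  rewrite /mul_s /mul_g /= ?zE ?oppr0 ?zE ?formE => e.
  by apply: (linear_combination e); ring.
- move=> X Y d; have := sy X 0 Y 0 0 d.
  rewrite /mul_s /mul_g /= ?zE ?oppr0 ?zE ?formE !(skewC og d) => e.
  by apply: (linear_combination e); ring.
- move=> X b Z; have := sy X 0 0 b Z 0.
  rewrite /mul_s /mul_g /= ?zE ?oppr0 ?zE ?formE => e.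
  by apply: (linear_combination e); ring.
- move=> X b d; have := sy X 0 0 b 0 d.
  rewrite /mul_s /mul_g /= ?zE ?oppr0 ?zE ?formE => e.
  by apply: (linear_combination e); ring.
- move=> a b Z; have := sy 0 a 0 b Z 0.
  rewrite /mul_s /mul_g /= ?zE ?oppr0 ?zE ?formE => e.
  by apply: (linear_combination e); ring.
- move=> a b d; have := sy 0 a 0 b 0 d.
  rewrite /mul_s /mul_g /= ?zE ?oppr0 ?zE ?formE => e.
  by apply: (linear_combination e); ring.
Qed.

End Model.

(** * From the structure equations to the components *)

Lemma alternating_anti (K : fieldType) (V : vectType K)
    (f : {bilinear V -> V -> V}) :
  (forall a, f a a = 0) -> forall a b, f a b = - f b a.
Proof.
move=> alt a b; apply/eqP; rewrite -addr_eq0; apply/eqP.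
by have := alt (a + b); rewrite mulDl !mulDr !alt add0r addr0.
Qed.

Lemma mapSE (K : fieldType) (g h : vectType K) (F G : 'Hom(h, 'End(g))) X a :
  mapS F G X a = F X a + G X a.
Proof. exact: add_lfunE. Qed.

Section Structure.
Variables (K : fieldType) (g h : vectType K).
Variables (br : {bilinear g -> g -> g}) (og : {skew_symmetric g}).
Variables (F G : 'Hom(h, 'End(g))).
Variable (Omega : 'Hom(h, 'Hom(h, 'Hom(h, K^o)))).
Variables (theta psi xi : {bilinear h -> h -> g}).

Local Notation S := (mapS F G).
Local Notation k Z a b := (og (Defs.mapK og F G Z a) b).

(** The structure equations freed of adjoints by pairing with vectors. In this form [st_br_S] says
    that [S X] takes central values. *)
Record structure_components : Prop := StructureComponents {
  st_Omega X Y Z : Omega X Z Y - Omega Y Z X =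
    2^-1 * Omega X Y Z - 2^-1 * Omega Y X Z;
  st_psi_xi X Y : psi X Y - psi Y X = xi Y X - xi X Y;
  st_theta X Y : theta X Y = xi Y X + 2^-1 *: psi X Y - 2^-1 *: xi X Y;
  st_cocycle X Y Z T : og (theta X Y) (xi Z T) - og (theta Y Z) (psi X T)
     + og (theta X Z) (psi Y T) = 0;
  st_F_theta X Y Z : F X (theta Y Z) - F Y (theta X Z) + F Z (theta X Y) =
    S Z (theta X Y);
  st_F_psi X Y Z c :
    og (psi Y Z) (F X c) - og (psi X Z) (F Y c) + k Z (theta X Y) c = 0;
  st_F_xi X Y Z c : og (psi Y Z) (F X c) + og (xi Y Z) (F X c)
    - og (psi X Z) (S Y c) - og (theta X Y) (S Z c) = 0;
  st_ad_theta X Y c : br (theta X Y) c = F X (F Y c) - F Y (F X c);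
  st_R_psi X Y a b : - og (psi X Y) (br a b) = og (F Y (F X a)) b
    + og (F X a) (F Y b) + og (F Y a) (F X b) + og a (F Y (F X b));
  st_R_xi X Y a b : og (psi X Y) (br a b) + og (xi X Y) (br a b) = 0;
  st_br_S X a b : br a (S X b) = 0;
  st_S_skew X a b : og (S X a) b = - og a (S X b);
  st_S_xi X Y Z : S X (xi Y Z) = 0;
  st_SS X Y a : S X (S Y a) = 0;
  st_FS X Y a : F X (S Y a) = 0;
  st_SF X Y a : S X (F Y a) = 0 }.

Hypothesis nd : nondegenerate og.

Let adjE := adjointPl nd.

Lemma lsym_formE a b c : og (lsym br og a b) c = - og b (br a c).
Proof. by rewrite formNl adjE lmulE. Qed.

Lemma structure_equationsP :
  structure_equations br og F G Omega theta psi xi <-> structure_components.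
Proof.
split.
  case=> e1 [e2 [e3 [e4 [e5 [e6 [e7 [e8 [e9 [e10 [e11 [e12 [e13 e14]]]]]]]]]]]].
  have sk X a b : og (S X a) b = - og a (S X b).
    by rewrite -(opprK (S X a)) -opp_lfunE -e12 formNl adjE.
  split=> //.
  - move=> X Y Z c; have := congr1 (og^~ c) (e6 X Y Z).
    by rewrite /= !formE !adjE Defs.form0l.
  - move=> X Y Z c; have := congr1 (og^~ c) (e7 X Y Z).
    by rewrite /= !(formDl og) adjE !sk Defs.form0l formDl.
  - move=> X Y c; rewrite -lmulE e8.
    by rewrite add_lfunE opp_lfunE !comp_lfunE.
  - move=> X Y a b; have := congr1 (fun f : 'End(g) => og (f a) b) (e9 X Y).
    rewrite /= lsym_rmulE lsym_formE => ->.
    rewrite !(add_lfunE, comp_lfunE).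
    by rewrite !(formDl og) !adjE !(formDl og) !adjE addrA.
  - move=> X Y a b; have := congr1 (fun f : 'End(g) => og (f a) b) (e10 X Y).
    rewrite /= lsym_rmulE lsym_formE zero_lfunE Defs.form0l formDl.
    by move/eqP; rewrite oppr_eq0 => /eqP.
  (* Skewness of [S X] and [lsym_formE] turn [og (S X (lsym br og a c)) b] into
     [og c (br a (S X b))]. *)
  - move=> X a b; apply: (form_inj nd) => c; rewrite Defs.form0l skewC.
    have := sk X (lsym br og a c) b.
    by rewrite e11 Defs.form0l lsym_formE opprK => <-; rewrite oppr0.
  - by move=> X Y a; have [/lfunP/(_ a) + _ _] := e14 X Y;
      rewrite comp_lfunE zero_lfunE.
  - by move=> X Y a; have [_ /lfunP/(_ a) + _] := e14 X Y;
      rewrite comp_lfunE zero_lfunE.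
  - by move=> X Y a; have [_ _ /lfunP/(_ a)] := e14 X Y;
      rewrite comp_lfunE zero_lfunE.
case=> e1 e2 e3 e4 e5 e6 e7 e8 e9 e10 e11 e12 e13 e14 e15 e16.
split; first exact: e1.
split; first exact: e2.
split; first exact: e3.
split; first exact: e4.
split; first exact: e5.
split; last split; last split; last split; last split; last split; last split;
  last split.
- move=> X Y Z; apply: (form_inj nd) => c.
  by rewrite !formE !adjE Defs.form0l.
- move=> X Y Z; apply: (form_inj nd) => c.
  by rewrite !(formDl og) adjE !e12 Defs.form0l formDl.
- move=> X Y; apply/lfunP => c.
  by rewrite lmulE e8 add_lfunE opp_lfunE !comp_lfunE.
- move=> X Y; apply: (lfun_form_inj nd) => a b.
  rewrite lsym_rmulE lsym_formE e9.
  rewrite !(add_lfunE, comp_lfunE).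
  by rewrite !(formDl og) !adjE !(formDl og) !adjE addrA.
- move=> X Y; apply: (lfun_form_inj nd) => a b.
  by rewrite lsym_rmulE lsym_formE zero_lfunE Defs.form0l formDl e10 oppr0.
- move=> X a b; apply: (form_inj nd) => c.
  by rewrite e12 lsym_formE e11 form0r Defs.form0l !oppr0.
- move=> X; apply: (lfun_form_inj nd) => a b.
  by rewrite adjE opp_lfunE formNl e12 opprK.
- exact: e13.
by move=> X Y; split; apply/lfunP => a;
  rewrite comp_lfunE zero_lfunE (e14, e15, e16).
Qed.

Lemma mapK_form_scalar Z a b : k Z a b =
  2^-1 * (og (F Z a) b + og (G Z a) b) - og (F Z a) b - og a (F Z b).
Proof.
by rewrite !(add_lfunE, opp_lfunE, scale_lfunE) !(formDl og) !(formNl og)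
  (formZl og) (formDl og) adjE.
Qed.

Hypothesis lie : symplectic_lie br og.
Hypothesis der : forall X, derivation br (F X) /\ derivation br (G X).
Hypothesis st : structure_components.

Hypothesis nz2 : 2 != 0 :> K.

Lemma structure_leibniz :
  leibniz_components br og F G theta psi xi.
Proof.
have [[alt jac] _ closed] := lie.
have anti := alternating_anti alt.
case: st => e1 e2 e3 e4 e5 e6 e7 e8 e9 e10 e11 e12 e13 e14 e15 e16.
have GE X a : G X a = S X a - F X a by rewrite mapSE addrAC subrr add0r.
have dF X a b : F X (br a b) = br (F X a) b + br a (F X b).
  by have [-> _] := der X.
have dG X a b : G X (br a b) = br (G X a) b + br a (G X b).
  by have [_ ->] := der X.
have kE Z a b : k Z a b =
    2^-1 * og (S Z a) b - og (F Z a) b - og a (F Z b).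
  by rewrite mapK_form_scalar mapSE formDl.
have cl a b c : og (br a b) c - og a (br b c) + og b (br a c) = 0.
  by have := closed a b c; rewrite (skewC og (br b c)) (anti c a) (formNl og)
    (skewC og (br a c)) opprK.
have S0l T a b : S T a = 0 -> og a (S T b) = 0.
  by move=> a0; apply/eqP; rewrite -oppr_eq0 -e12 a0 Defs.form0l.
(* [S X] is a derivation with central values, so it kills brackets. *)
have SD X a b : S X (br a b) = 0.
  rewrite mapSE dF dG addrACA -(mulDr br) -(mulDl br) -!mapSE.
  by rewrite (anti (S X a)) !e11 oppr0 addr0.
have kr T t b : k T b t = - (2^-1 * og t (S T b)) + og t (F T b) + og (F T t) b.
  by rewrite kE (skewC og (S T b)) (skewC og (F T b)) (skewC og b); ring.
have kl T t b : k T t b = - (2^-1 * og t (S T b)) - og (F T t) b - og t (F T b).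
  by rewrite kE e12; ring.
split.
- move=> X Y Z; have e := e5 X Y Z; rewrite mapSE in e.
  by pair_combination nd og e; ring.
- by move=> X Y c; have e := esym (e8 X Y c); pair_combination nd og e; ring.
- move=> X b Z; have e := e8 X Z b; rewrite anti in e.
  by rewrite !GE linearB /= e15 e16; pair_combination nd og e; ring.
- move=> a Y Z; have e := esym (e8 Y Z a); rewrite [in RHS]anti in e.
  by rewrite !GE !linearB /= e14 e15 e15 e16; pair_combination nd og e; ring.
- exact: dF.
- move=> a Y c; have e : br (S Y a) c = 0 by rewrite anti e11 oppr0.
  by rewrite dF GE mulDl linearNl e add0r addrA addNr add0r.
- by move=> a b Z; rewrite dG [br b _]anti addrAC subrr add0r.
- move=> a b c; have e := jac a b c.
  rewrite (anti c (br a b)) (anti c a) linearN /= in e.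
  by pair_combination nd og e; ring.
- move=> X Y Z T; have e := e4 X Y Z T.
  rewrite !(skewC og (theta _ _)) in e.
  by apply: (linear_combination e); ring.
- move=> X Y c T; have e := esym (e6 X Y T c).
  by apply: (linear_combination e); ring.
(* Subtracting [st_F_xi] from [st_F_psi] cancels [og (psi Z T) (F X b)]; the rest is the claim with
   G = S - F. *)
- move=> X b Z T; have e := congr2 (fun x y => y - x) (e7 X Z T b) (e6 X Z T b).
  rewrite /= kl in e; rewrite kr GE formBr.
  by apply: (linear_combination e); field.
- move=> a Y Z T; have e := congr2 (fun x y => x - y) (e7 Y Z T a) (e6 Y Z T a).
  rewrite /= kl in e; rewrite kr !GE !(Defs.formBr og) (S0l Y) //.
  by apply: (linear_combination e); field.
- move=> X b c T; have e := esym (e9 X T b c).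
  rewrite !kE e16 Defs.form0l (skewC og (S T b)) (S0l T _ b) ?e16 //.
  by apply: (linear_combination e); field.
- move=> a Y c T; have e := e9 Y T a c.
  rewrite !kE GE !e12 linearB /= e15 e16.
  rewrite !(Defs.form0l og, form0r og, formBl) !e12.
  rewrite e14 e16 form0r (S0l T (F Y a)) ?e16 //.
  by apply: (linear_combination e); field.
- move=> a b Z T.
  have e := congr2 (fun x y => x + y) (e9 Z T a b) (e10 Z T a b).
  rewrite !kE !GE !(Defs.formBr og) !linearB /= !e15 !e12 !e14 !e16 !form0r.
  rewrite (S0l Z (F T a)) ?e16 // (S0l Z (F T b)) ?e16 // !add0r.
  rewrite (skewC og (F T b)) (skewC og b (F T _)).
  by apply: (linear_combination (esym e)); ring.
- move=> a b c T.
  (* The derivation [F T] is applied to each of the three slots of the closedness identity in turn;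
     the S terms vanish because S kills brackets. *)
  have e := congr2 +%R
    (congr2 +%R (cl (F T a) b c) (cl a (F T b) c)) (cl a b (F T c)).
  rewrite !kE !e12 !SD !dF !(formDl og, formDr og) !form0r.
  rewrite (S0l T (br a b)) ?SD //.
  by apply: (linear_combination e); field.
Qed.

Lemma structure_symplectic :
  symplectic_components br og F G Omega theta psi xi.
Proof.
have [[alt _] _ closed] := lie.
have anti := alternating_anti alt.
case: st => e1 e2 e3 _ _ _ _ _ _ _ _ e12 _ _ _ _.
have GE X a : G X a = S X a - F X a by rewrite mapSE addrAC subrr add0r.
split.
- move=> X Y Z; apply: (linear_combination (esym (e1 X Y Z))); ring.
- move=> X Y c; have [e e'] := (e3 X Y, e3 Y X); have e'' := e2 X Y.
  have {e} := congr1 (og^~ c) e; have {e'} := congr1 (og^~ c) e'.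
  have {e''} := congr1 (og^~ c) e''.
  rewrite /= !(formDl og, formNl og, formZl og) => e -> ->.
  (* Once [st_theta] has replaced both values of theta, the claim is -3/4 times [st_psi_xi]. *)
  apply: (linear_combination (congr1 ( *%R (- (3 * 2^-1 * 2^-1))) e)).
  by field.
- move=> X b Z; have := congr1 (og^~ b) (e3 X Z).
  rewrite /= !(formDl og, formNl og, formZl og) => ->; ring.
- move=> X b c; rewrite mapK_form_scalar !(skewC og c) (skewC og (F X c)).
  by field.
- move=> a b Z; rewrite !mapK_form_scalar !GE !formBl e12 (skewC og (S Z a)).
  rewrite (skewC og b (F Z a)) (skewC og a (F Z b)).
  by field.
- move=> a b c; rewrite (anti b a) (anti a c) (Defs.formNr og) (formNl og).
  have e := closed a b c; rewrite (skewC og (br a b)) in e.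
  by apply: (linear_combination e); field.
Qed.
End Structure.

(** * From the components to the structure equations *)

Section StructureOfComponents.
Variables (K : fieldType) (g h : vectType K).
Variables (br : {bilinear g -> g -> g}) (og : {skew_symmetric g}).
Variables (F G : 'Hom(h, 'End(g))).
Variable (Omega : 'Hom(h, 'Hom(h, 'Hom(h, K^o)))).
Variables (theta psi xi : {bilinear h -> h -> g}).

Local Notation S := (mapS F G).
Local Notation k Z a b := (og (Defs.mapK og F G Z a) b).

Hypothesis nd : nondegenerate og.
Hypotheses (nz2 : 2 != 0 :> K) (nz3 : 3 != 0 :> K).
Hypothesis alt : forall a, br a a = 0.
Hypothesis FS0 : forall X Y a, F X (S Y a) = 0.
Hypothesis lb : leibniz_components br og F G theta psi xi.
Hypothesis sy : symplectic_components br og F G Omega theta psi xi.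

Lemma components_derivation X : derivation br (F X) /\ derivation br (G X).
Proof.
split=> a b; first exact: (lg_hgg lb).
have e := esym (lg_ggh lb a b X).
by rewrite (alternating_anti alt (G X a)); pair_combination nd og e; ring.
Qed.

Lemma components_structure : structure_components br og F G Omega theta psi xi.
Proof.
have anti := alternating_anti alt.
have GE X a : G X a = S X a - F X a by rewrite mapSE addrAC subrr add0r.
have kE Z a b : k Z a b =
    2^-1 * og (S Z a) b - og (F Z a) b - og a (F Z b).
  by rewrite mapK_form_scalar // mapSE formDl.
have e3 X Y : theta X Y = xi Y X + 2^-1 *: psi X Y - 2^-1 *: xi X Y.
  apply: (form_inj nd) => w; rewrite !(formDl og, formNl og, formZl og).
  by apply: (linear_combination (esym (sy_hgh sy X w Y))); ring.
have e8 X Y c : br (theta X Y) c = F X (F Y c) - F Y (F X c).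
  by rewrite (lg_hhg lb) addrK.
have sk X a b : og (S X a) b = - og a (S X b).
  rewrite (skewC og a) opprK; have := sy_ggh sy a b X; rewrite !kE !GE !formBl.
  rewrite (skewC og a) (skewC og b) => e.
  (* The F terms cancel, leaving 3/4 of [og (S X a) b + og a (S X b)] equal to zero up to sign; this
     is where 3 must be invertible. *)
  apply: (linear_combination (congr1 ( *%R (- (2 * 2 / 3))) e)).
  by field; apply/andP.
(* With G = S - F and [e8] for [br (theta Y X) a], all products of two F cancel and [FS0] removes
   [F Y (S X a)], so only [S X (F Y a)] is left. The proof of [SS] is similar. *)
have SF X Y a : S X (F Y a) = 0.
  have e := esym (lg_hgh lb Y a X); rewrite !GE linearB /= FS0 anti e8 in e.
  by pair_combination nd og e; ring.
have SS X Y a : S X (S Y a) = 0.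
  have e := esym (lg_ghh lb a Y X).
  rewrite !GE !linearB /= !FS0 SF anti e8 in e.
  by pair_combination nd og e; ring.
have S0l T a b : S T a = 0 -> og a (S T b) = 0.
  by move=> a0; apply/eqP; rewrite -oppr_eq0 -sk a0 Defs.form0l.
(* Adding the Leibniz identities for (X, b, Y) and (b, X, Y) expresses that X b + b X, an element of
   Leib, multiplies to zero from the left. *)
have xiS X Y Z b : og (xi Y Z) (S X b) = 0.
  have e := congr2 +%R (lg_hgh lb X b Y) (lg_ghh lb b X Y).
  have {}e := congr2 +%R (ls_hgh lb X b Y Z) (ls_ghh lb b X Y Z).
  by rewrite mapSE formDr; apply: (linear_combination (esym e)); ring.
have e9 X Y a b : - og (psi X Y) (br a b) = og (F Y (F X a)) b
    + og (F X a) (F Y b) + og (F Y a) (F X b) + og a (F Y (F X b)).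
  have e := ls_hgg lb X a b Y.
  rewrite !kE SF Defs.form0l (skewC og (S Y a)) (S0l Y _ a) ?SF // in e.
  by apply: (linear_combination (esym e)); field.
have kr T t b : k T b t = - (2^-1 * og t (S T b)) + og t (F T b) + og (F T t) b.
  by rewrite kE (skewC og (S T b)) (skewC og (F T b)) (skewC og b); ring.
have e6 X Y Z c :
    og (psi Y Z) (F X c) - og (psi X Z) (F Y c) + k Z (theta X Y) c = 0.
  by apply: (linear_combination (esym (ls_hhg lb X Y c Z))); ring.
split=> //.
- by move=> X Y Z; apply: (linear_combination (esym (sy_hhh sy X Y Z))); ring.
- move=> X Y; apply: (form_inj nd) => w; have := sy_hhg sy X Y w.
  rewrite !e3 !(formDl og, formNl og, formZl og) => e.
  (* Substituting [e3] makes the hypothesis 3/4 of the claim up to sign. *)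
  apply: (linear_combination (congr1 ( *%R (- (2 * 2 / 3))) e)).
  by field; apply/andP.
- move=> X Y Z T; have e := ls_hhh lb X Y Z T.
  rewrite !(skewC og (theta _ _)).
  by apply: (linear_combination e); ring.
- move=> X Y Z; have e := lg_hhh lb X Y Z; rewrite mapSE.
  by pair_combination nd og e; ring.
- move=> X Y Z c; have e := e6 X Y Z c; rewrite kE sk in e.
  have e' := ls_hgh lb X c Y Z; rewrite kr GE (Defs.formBr og) in e'.
  by apply: (linear_combination (congr2 (fun x y => x - y) e e')); field.
- move=> X Y a b; have := ls_ggh lb a b X Y; have := e9 X Y a b.
  rewrite !kE !GE !(Defs.formBr og) !linearB /= !FS0 !sk !SS !SF !form0r.
  rewrite (S0l X (F Y a)) ?SF // (S0l X (F Y b)) ?SF //.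
  rewrite (skewC og (F Y b)) (skewC og b (F Y _)) => e e'.
  by apply: (linear_combination (congr2 (fun x y => - x - y) e e')); ring.
(* Again left multiplication by X b + b X vanishes, now on an element of [g]. *)
- move=> X a b; have e := congr2 +%R (lg_ghg lb b X a) (lg_hgg lb X b a).
  by rewrite anti mapSE mulDl; pair_combination nd og e; ring.
- move=> X Y Z; apply: (form_inj nd) => w; by rewrite sk xiS Defs.form0l oppr0.
Qed.
End StructureOfComponents.

(** * Double orthogonals and representation of linear forms *)

Section Duality.
Variables (K : fieldType) (V : vectType K) (om : {skew_symmetric V}).
Hypothesis nd : nondegenerate om.

(** A vector [u] outside [U] survives the projection [q] along [U], so [om (q u) z] is nonzero for
    some [z]. Then [adjoint om q z] is orthogonal to [U], as [q] kills [U], but not to [u]. *)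
Lemma orthovK (U : {vspace V}) : orthov om (orthov om U) = U.
Proof.
apply/vspaceP => u; apply/idP/idP => [uO|uU]; last first.
  by apply/mem_orthovP => v /mem_orthovP vO; rewrite skewC vO ?oppr0.
apply: contraLR uO => uU; pose q : 'End(V) := daddv_pi (U^C) U.
have capC : (U^C :&: U = 0)%VS by rewrite capvC capv_compl.
have qU v : v \in U -> q v = 0.
  move=> vU; have := daddv_pi_add capC (w := v).
  rewrite addvC addv_complf memvf (daddv_pi_id (capv_compl U) vU) => /(_ isT).
  by rewrite -[RHS]add0r => /addIr.
have q0 : q u != 0.
  apply: contraNneq uU => q0; have := daddv_pi_add capC (w := u).
  rewrite addvC addv_complf memvf -/q q0 add0r => /(_ isT) <-.
  exact: memv_pi.
have [z _ omz] : exists2 z, z \in fullv & om (q u) z != 0.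
  by apply/mem_orthovPn; rewrite (eqP nd) memv0.
apply/mem_orthovPn; exists (adjoint om q z); last by rewrite -adjointP.
apply/mem_orthovP => v vU.
by rewrite adjointPl // skewC qU // Defs.form0l oppr0.
Qed.

Definition form_rep (f : 'Hom(V, K^o)) : V := (linfun (form_dual om))^-1%VF f.

(** [form_dual] is injective by nondegeneracy, hence onto the dual by equality of dimensions. *)
Lemma form_repE f u : om u (form_rep f) = f u.
Proof.
rewrite -form_dualE -(lfunE (form_dual om)) limg_lfunVK //.
suff -> : limg (linfun (form_dual om)) = fullv by rewrite memvf.
have ker0 : lker (linfun (form_dual om)) == 0%VS.
  rewrite -subv0; apply/subvP => v; rewrite memv_ker memv0 lfunE => /eqP v0.
  apply/eqP/(nondegenerate_eq0 nd) => w.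
  by rewrite skewC -form_dualE v0 lfunE oppr0.
apply/eqP; rewrite eqEdim subvf limg_dim_eq ?(eqP ker0) ?capv0 //.
by rewrite !dimvf -[X in (X <= _)%N]/(dim V * 1)%N muln1 leqnn.
Qed.

Lemma form_rep_linear : linear form_rep.
Proof. exact: linearP. Qed.
End Duality.

(** * Sections, projections and structure maps attached to the core *)

Section Forward.
Variables (K : fieldType) (A : vectType K).
Variables (mul : {bilinear A -> A -> A}) (om : {skew_symmetric A}).

Local Notation I := (core_ideal mul om).
Local Notation P := (core_perp mul om).
Local Notation g := (core_g mul om).
Local Notation h := (core_h mul om).
Local Notation br := (core_br mul om : {bilinear g -> g -> g}).
Local Notation og := (core_form mul om : {skew_symmetric g}).

Definition rmul (v : A) : 'End(A) := linfun (applyr mul v).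

Lemma rmulE v u : rmul v u = mul u v.
Proof. by rewrite lfunE. Qed.

Fact rmul_is_linear : linear rmul.
Proof.
move=> k u v; apply/lfunP => w.
by rewrite add_lfunE scale_lfunE !rmulE linearPr.
Qed.
HB.instance Definition _ :=
  GRing.isLinear.Build K A 'End(A) *:%R rmul rmul_is_linear.

Definition proj_h : 'Hom(A, h) := linfun (quot_pi P).

Definition form_along (f : 'Hom(h, A)) : 'Hom(A, 'Hom(h, K^o)) :=
  linfun (fun v => linfun (fun Y => om v (f Y) : K^o)).

Lemma form_alongE f v Y : form_along f v Y = om v (f Y).
Proof.
have lin w : linear (fun Y => om w (f Y) : K^o).
  by move=> k X X'; rewrite linearP linearPr.
rewrite linfunE; first by rewrite linfunE.
move=> k u w; apply/lfunP => X.
by rewrite add_lfunE scale_lfunE !(linfunE (lin _)) linearPl.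
Qed.

(** Embeds [h^*] into [I]. The sign appears because [form_rep] represents a form in the second slot
    of [om], whereas the model pairs [h^*] in the first. *)
Definition sec_dual : 'Hom('Hom(h, K^o), A) :=
  linfun (fun al => - form_rep om (al \o proj_h)%VF).

(* The correction by half of the form makes the image isotropic. *)
Definition sec_h : 'Hom(h, A) :=
  quot_sec P - 2^-1 *: (sec_dual \o form_along (quot_sec P) \o quot_sec P)%VF.

Definition lift_g : 'Hom(g, A) := linfun (@core_lift K A mul om).

(** The correction lies in [I], so it preserves classes in [g]; it makes the image orthogonal to
    that of [sec_h]. *)
Definition sec_g : 'Hom(g, A) :=
  lift_g - (sec_dual \o form_along sec_h \o lift_g)%VF.

(** Removing the [sec_h] part brings [u] into [P], where [core_proj] is the quotient map. *)
Definition proj_g : 'Hom(A, g) :=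
  linfun (fun u => core_proj mul om (u - sec_h (proj_h u))).

Definition map_F : 'Hom(h, 'End(g)) :=
  linfun (fun X => (proj_g \o lmul mul (sec_h X) \o sec_g)%VF).

Definition map_G : 'Hom(h, 'End(g)) :=
  linfun (fun X => (proj_g \o rmul (sec_h X) \o sec_g)%VF).

Definition map_Omega : 'Hom(h, 'Hom(h, 'Hom(h, K^o))) :=
  linfun (fun X => (form_along sec_h \o lmul mul (sec_h X) \o sec_h)%VF).

Definition map_theta (X Y : h) : g := proj_g (mul (sec_h X) (sec_h Y)).

(** Chosen so that pairing with [a] gives the [h^*] component of the product of X and a; the adjoint
    isolates [a], and the sign comes from skewness. *)
Definition map_psi (X Y : h) : g :=
  - proj_g (adjoint om (lmul mul (sec_h X)) (sec_h Y)).

Definition map_xi (X Y : h) : g :=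
  - proj_g (adjoint om (rmul (sec_h X)) (sec_h Y)).

Fact map_theta_is_bilinear : bilinear_for *:%R *:%R map_theta.
Proof.
by split=> [Y k X X'|X k Y Y']; rewrite /map_theta !linearP // linearPl linearP.
Qed.
HB.instance Definition _ := bilinear_isBilinear.Build K h h g *:%R *:%R
  map_theta map_theta_is_bilinear.

Fact map_psi_is_bilinear : bilinear_for *:%R *:%R map_psi.
Proof.
split=> [Y k X X'|X k Y Y']; rewrite /map_psi (linearP sec_h) /=.
  rewrite (linearP (lmul mul)) (linearP (adjoint om)) add_lfunE scale_lfunE.
  by rewrite (linearP proj_g) opprD scalerN.
by rewrite (linearP (adjoint om _)) (linearP proj_g) opprD scalerN.
Qed.
HB.instance Definition _ := bilinear_isBilinear.Build K h h g *:%R *:%R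
  map_psi map_psi_is_bilinear.

Fact map_xi_is_bilinear : bilinear_for *:%R *:%R map_xi.
Proof.
split=> [Y k X X'|X k Y Y']; rewrite /map_xi (linearP sec_h) /=.
  rewrite (linearP (rmul)) (linearP (adjoint om)) add_lfunE scale_lfunE.
  by rewrite (linearP proj_g) opprD scalerN.
by rewrite (linearP (adjoint om _)) (linearP proj_g) opprD scalerN.
Qed.
HB.instance Definition _ := bilinear_isBilinear.Build K h h g *:%R *:%R
  map_xi map_xi_is_bilinear.

Hypothesis char0 : [pchar K] =i pred0.
Hypothesis symp : symplectic_left_leibniz mul om.

Let nd : nondegenerate om. Proof. by case: symp. Qed.

Let nz2 : 2 != 0 :> K.
Proof. by rewrite ((pcharf0P K).1 char0 2). Qed.

Let nz3 : 3 != 0 :> K.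
Proof. by rewrite ((pcharf0P K).1 char0 3). Qed.

(** * Products involving [I] and Leib *)

Lemma core_ideal_form_mul i u v : i \in I -> om i (mul u v) = 0.
Proof.
move=> iI; have [iL iO] := core_idealP _ _ _ iI.
have := iO _ (leib_mem mul u v).
rewrite formDr (leib_form_comm char0 symp v u iL) -mulr2n -mulr_natr => /eqP.
by rewrite mulf_eq0 (negPf nz2) orbF => /eqP.
Qed.

Lemma mul_core_perp u v : mul u v \in P.
Proof.
apply/core_perpP => i iI.
by rewrite skewC core_ideal_form_mul ?oppr0.
Qed.

(** By [leib_formE], [om w (mul v i)] is a multiple of [om (mul v w) i], which vanishes because
    products lie in [P]. *)
Lemma mul_core_ideal i v : i \in I -> mul v i = 0.
Proof.
move=> iI; have [iL _] := core_idealP _ _ _ iI.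
apply: (nondegenerate_eq0 nd) => w.
have := leib_formE symp v w iL.
rewrite skewC core_ideal_form_mul // oppr0 mulNr => /esym/eqP.
rewrite oppr_eq0 mulf_eq0 invr_eq0 (negPf nz2) /= => /eqP e.
by rewrite skewC e oppr0.
Qed.

(** For [l'] in Leib, [leib_formE] and [leib_form_comm] reduce [om (mul v l) l'] to a multiple of
    [om l (mul l' v)], and [mul l' v] is zero. *)
Lemma mul_leib l v : l \in leib mul -> mul v l \in I.
Proof.
move=> lL; apply/core_idealP; split; first exact: (leib_mulr symp).
move=> l' l'L; rewrite (leib_formE symp) // (leib_form_comm char0 symp) //.
by rewrite (leib_mull symp) // form0r mulr0.
Qed.

(** This makes the induced product on [g] alternating. The square is half an element of Leib, and
    pairing it with [l] in Leib gives a multiple of [om u (mul u l)], where [mul u l] lies in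
    [I]. *)
Lemma core_perp_sqr u : u \in P -> mul u u \in I.
Proof.
move=> uP; apply/core_idealP; split.
  have := leib_mem mul u u; rewrite -mulr2n -scaler_nat => uuL.
  by rewrite -[mul u u](scalerK nz2) rpredZ.
move=> l lL; rewrite (leib_formE symp) //.
by rewrite (core_perpP _ _ _ uP) ?mulr0 // mul_leib.
Qed.

(** * The splitting of the algebra adapted to the form *)

Lemma proj_hE u : proj_h u = quot_pi P u.
Proof. exact: lfunE. Qed.

Lemma proj_h_eq0 u : (proj_h u == 0) = (u \in P).
Proof. by rewrite proj_hE quot_pi_eq0. Qed.

Lemma lift_gE a : lift_g a = core_lift a.
Proof. by apply: linfunE => k b c; rewrite /core_lift !linearP. Qed.

Lemma core_proj_linear : linear (core_proj mul om).
Proof. by move=> k u v; rewrite /core_proj !linearP. Qed.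

Lemma proj_gE u : proj_g u = core_proj mul om (u - sec_h (proj_h u)).
Proof.
apply: linfunE => k v w.
rewrite -core_proj_linear (linearP proj_h) (linearP sec_h) /=.
congr core_proj.
by rewrite scalerBr opprD addrACA.
Qed.

Lemma form_sec_dual al u : om (sec_dual al) u = al (proj_h u).
Proof.
have -> : sec_dual al = - form_rep om (al \o proj_h)%VF.
  apply: linfunE => k be ga; rewrite comp_lfunDl -comp_lfunZl form_rep_linear.
  by rewrite scalerN opprD.
by rewrite skewC Defs.formNr opprK form_repE // comp_lfunE.
Qed.

(** [I] is the orthogonal of [P], and [sec_dual al] pairs through [proj_h], which vanishes on
    [P]. *)
Lemma sec_dual_ideal al : sec_dual al \in I.
Proof.
rewrite -(orthovK nd I); apply/mem_orthovP => u uP.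
by rewrite form_sec_dual (eqP (_ : proj_h u == 0)) ?proj_h_eq0 ?linear0.
Qed.

Lemma ideal_form i u : i \in I -> u \in P -> om i u = 0.
Proof. by move=> iI uP; rewrite skewC (core_perpP _ _ _ uP) ?oppr0. Qed.

Lemma ideal_perp i : i \in I -> i \in P.
Proof. exact/subvP/core_ideal_perp. Qed.

Lemma proj_h_ideal i : i \in I -> proj_h i = 0.
Proof. by move=> iI; apply/eqP; rewrite proj_h_eq0 ideal_perp. Qed.

Lemma sec_hE X : sec_h X =
  quot_sec P X - 2^-1 *: sec_dual (form_along (quot_sec P) (quot_sec P X)).
Proof. by rewrite !lfun_simp. Qed.

Lemma proj_sec_h X : proj_h (sec_h X) = X.
Proof.
rewrite sec_hE linearB linearZ /= (proj_h_ideal (sec_dual_ideal _)).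
by rewrite scaler0 subr0 proj_hE quot_secK.
Qed.

Lemma form_ideal_l i j : i \in I -> j \in I -> om i j = 0.
Proof. by move=> iI jI; rewrite ideal_form // ideal_perp. Qed.

Lemma sec_h_isotropic X Y : om (sec_h X) (sec_h Y) = 0.
Proof.
have e Z : proj_h (quot_sec P Z) = Z by rewrite proj_hE quot_secK.
(* Each mixed term removes half of the form on the original section; the two corrections pair to
   zero as [I] is isotropic. *)
rewrite !sec_hE !(formDl, formDr, formNl, Defs.formNr, formZl, Defs.formZr).
rewrite (form_ideal_l (sec_dual_ideal _) (sec_dual_ideal _)).
rewrite (skewC om (quot_sec P X) (sec_dual _)) !form_sec_dual !e !form_alongE.
by rewrite (skewC om (quot_sec P Y)); field.
Qed.

Lemma sec_gE a :
  sec_g a = core_lift a - sec_dual (form_along sec_h (core_lift a)).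
Proof. by rewrite !lfun_simp lift_gE. Qed.

Lemma sec_g_perp a : sec_g a \in P.
Proof.
by rewrite sec_gE rpredB ?core_lift_perp // ideal_perp ?sec_dual_ideal.
Qed.

Lemma form_sec_gh a X : om (sec_g a) (sec_h X) = 0.
Proof.
by rewrite sec_gE formDl formNl form_sec_dual proj_sec_h form_alongE subrr.
Qed.

Lemma proj_h_sec_g a : proj_h (sec_g a) = 0.
Proof. by apply/eqP; rewrite proj_h_eq0 sec_g_perp. Qed.

Lemma proj_h_mul u v : proj_h (mul u v) = 0.
Proof. by apply/eqP; rewrite proj_h_eq0 mul_core_perp. Qed.

Lemma proj_g_perp u : u \in P -> proj_g u = core_proj mul om u.
Proof. by rewrite proj_gE -proj_h_eq0 => /eqP ->; rewrite linear0 subr0. Qed.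

Lemma proj_g_ideal i : i \in I -> proj_g i = 0.
Proof.
move=> iI; rewrite proj_g_perp ?ideal_perp //.
have e : core_proj mul om 0 = 0 by rewrite /core_proj !linear0.
by apply/eqP; rewrite -e core_proj_eq ?rpred0 ?ideal_perp ?subr0.
Qed.

Lemma proj_g_sec_h X : proj_g (sec_h X) = 0.
Proof. by rewrite proj_gE proj_sec_h subrr /core_proj !linear0. Qed.

Lemma proj_sec_g a : proj_g (sec_g a) = a.
Proof.
rewrite sec_gE linearB /= (proj_g_ideal (sec_dual_ideal _)) subr0.
by rewrite proj_g_perp ?core_lift_perp ?core_liftK.
Qed.

(** Orthogonality to [sec_h] leaves only the part of [u] in [P], and there [om] descends to [og]. *)
Lemma form_sec_g a u : om (sec_g a) u = og a (proj_g u).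
Proof.
rewrite -{1}(subrK (sec_h (proj_h u)) u) formDr form_sec_gh addr0.
rewrite -{2}(proj_sec_g a) (proj_g_perp (sec_g_perp a)) proj_gE.
rewrite [RHS]core_formE ?sec_g_perp //.
by rewrite -proj_h_eq0 linearB /= proj_sec_h subrr.
Qed.

Lemma core_form_nondegenerate : nondegenerate og.
Proof.
apply/nondegenerateP => a a0; rewrite -(proj_sec_g a).
rewrite (_ : sec_g a = 0) ?linear0 //; apply: (nondegenerate_eq0 nd) => u.
by rewrite form_sec_g a0.
Qed.

(** The remainder lies in [I], so it is orthogonal to [P]; the last summand is chosen to make it
    orthogonal to the image of [sec_h] too. These span everything, so it is zero. *)
Lemma core_decomposition u :
  u = sec_h (proj_h u) + sec_g (proj_g u) + sec_dual (form_along sec_h u).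
Proof.
apply/eqP; rewrite -subr_eq0; set r := _ - _.
have rP : u - sec_h (proj_h u) \in P.
  by rewrite -proj_h_eq0 linearB /= proj_sec_h subrr.
have rI : r \in I.
  rewrite /r sec_gE !opprD opprK !addrA.
  rewrite rpredB ?sec_dual_ideal // rpredD ?sec_dual_ideal //.
  by rewrite -memvN opprB proj_gE core_lift_proj.
apply/eqP/(nondegenerate_eq0 nd) => v.
rewrite -(subrK (sec_h (proj_h v)) v) formDr ideal_form //; last first.
  by rewrite -proj_h_eq0 linearB /= proj_sec_h subrr.
rewrite add0r /r formDl formNl !formDl sec_h_isotropic form_sec_gh.
by rewrite form_sec_dual proj_sec_h form_alongE !add0r subrr.
Qed.

(** * Transport of product and form to the model *)

Local Notation mmul :=
  (model_mul br og map_F map_G map_Omega map_theta map_psi map_xi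
    : {bilinear model g h -> model g h -> model g h}).
Local Notation mform := (model_form h og : {skew_symmetric model g h}).

Lemma map_FE X a : map_F X a = proj_g (mul (sec_h X) (sec_g a)).
Proof.
rewrite /map_F linfunE; first by rewrite !comp_lfunE lmulE.
move=> k Y Y'; apply/lfunP => b.
rewrite [RHS]add_lfunE [X in _ = X + _]scale_lfunE !comp_lfunE !lmulE.
rewrite (linearP sec_h) linearPl.
exact: linearP.
Qed.

Lemma map_GE X a : map_G X a = proj_g (mul (sec_g a) (sec_h X)).
Proof.
rewrite /map_G linfunE; first by rewrite !comp_lfunE rmulE.
move=> k Y Y'; apply/lfunP => b.
rewrite [RHS]add_lfunE [X in _ = X + _]scale_lfunE !comp_lfunE !rmulE.
rewrite (linearP sec_h) linearPr.
exact: linearP.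
Qed.

Lemma map_OmegaE X Y Z :
  map_Omega X Y Z = om (mul (sec_h X) (sec_h Y)) (sec_h Z).
Proof.
rewrite /map_Omega linfunE.
  by rewrite !comp_lfunE lmulE form_alongE.
move=> k T T'; apply/lfunP => b; apply/lfunP => c.
rewrite 2![in RHS]add_lfunE 2![in RHS]scale_lfunE !comp_lfunE.
rewrite !lmulE !form_alongE.
by rewrite (linearP sec_h) linearPl linearPl.
Qed.

Lemma form_map_psi X Z a :
  og (map_psi X Z) a = om (mul (sec_h X) (sec_g a)) (sec_h Z).
Proof.
by rewrite formNl -skewC -form_sec_g -adjointP // lmulE.
Qed.

Lemma form_map_xi X Z a :
  og (map_xi X Z) a = om (mul (sec_g a) (sec_h X)) (sec_h Z).
Proof.
by rewrite formNl -skewC -form_sec_g -adjointP // rmulE.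
Qed.

Lemma proj_g_mul a b : proj_g (mul (sec_g a) (sec_g b)) = br a b.
Proof.
rewrite proj_g_perp ?mul_core_perp // -core_brE ?sec_g_perp //.
by rewrite -!proj_g_perp ?sec_g_perp // !proj_sec_g.
Qed.

(** The symplectic identity with first argument [sec_h Z] expresses the left side through F and G,
    and [mapK] is exactly the resulting combination. *)
Lemma form_mul_sec_g a b Z : om (mul (sec_g a) (sec_g b)) (sec_h Z) =
  og (Defs.mapK og map_F map_G Z a) b.
Proof.
have := symplectic_leibE symp (sec_h Z) (sec_g a) (sec_g b).
rewrite (skewC om _ (sec_g a)) Defs.formBr !form_sec_g -map_FE -map_GE -map_FE.
rewrite (mapK_form_scalar _ _ core_form_nondegenerate) !(skewC og b) => e.
by apply: (linear_combination e); field.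
Qed.

Definition to_model : 'Hom(A, model g h) :=
  linfun (fun u => (proj_h u, proj_g u, form_along sec_h u)).

Lemma to_modelE u : to_model u = (proj_h u, proj_g u, form_along sec_h u).
Proof. by apply: linfunE => k v w; rewrite !linearP. Qed.

Definition of_model (u : model g h) : A :=
  sec_h u.1.1 + sec_g u.1.2 + sec_dual u.2.

Lemma to_modelK : cancel to_model of_model.
Proof. by move=> u; rewrite to_modelE /of_model /= -core_decomposition. Qed.

Lemma of_modelK : cancel of_model to_model.
Proof.
move=> [[X a] al]; rewrite to_modelE /of_model /=.
rewrite !(linearD proj_h) !(linearD proj_g) /= proj_sec_h proj_h_sec_g.
rewrite (proj_h_ideal (sec_dual_ideal _)).
rewrite proj_g_sec_h proj_sec_g (proj_g_ideal (sec_dual_ideal _)) !addr0 add0r.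
congr (_, _); apply/lfunP => Y.
rewrite form_alongE !formDl sec_h_isotropic form_sec_gh form_sec_dual.
by rewrite proj_sec_h !add0r.
Qed.

Lemma to_model_bij : bijective to_model.
Proof. by exists of_model; [exact: to_modelK|exact: of_modelK]. Qed.

Lemma to_model_isometry : isometry mform om to_model.
Proof.
move=> u v; rewrite !to_modelE /= !form_alongE -form_sec_g.
rewrite [in RHS](core_decomposition u) !formDl form_sec_dual form_alongE.
by rewrite (skewC om (sec_h _)); ring.
Qed.

Lemma to_model_morph : {morph to_model : u v / mul u v >-> mmul u v}.
Proof.
move=> u v.
(* The [I] parts multiply to zero on either side, so four products remain. *)
have mE : mul u v = mul (sec_h (proj_h u)) (sec_h (proj_h v))
    + mul (sec_h (proj_h u)) (sec_g (proj_g v))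
    + mul (sec_g (proj_g u)) (sec_h (proj_h v))
    + mul (sec_g (proj_g u)) (sec_g (proj_g v)).
  rewrite {1}(core_decomposition u) {1}(core_decomposition v).
  rewrite !mulDl (core_ideal_mull symp _ (sec_dual_ideal _)) addr0 !mulDr.
  by rewrite !(mul_core_ideal _ (sec_dual_ideal _)) !addr0 !addrA.
rewrite !to_modelE /=; congr (_, _, _).
- exact: proj_h_mul.
- rewrite mE !(linearD proj_g) /= -map_FE -map_GE proj_g_mul.
  by rewrite -!addrA; congr (_ + _); rewrite addrA addrC.
apply/lfunP => Z.
rewrite !add_lfunE form_alongE mE !formDl map_OmegaE mapK_formE !dual_formE.
by rewrite form_map_psi form_map_xi form_mul_sec_g; ring.
Qed.

Lemma model_left_leibniz : left_leibniz mmul.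
Proof.
move=> u v w; rewrite -(of_modelK u) -(of_modelK v) -(of_modelK w).
have [leibA _ _] := symp.
by rewrite -!to_model_morph leibA; apply: (linearD to_model).
Qed.

Lemma model_symplectic u v w : mform (mmul v w) u - mform (mmul u w) v
  = 2^-1 * mform w (mmul u v - mmul v u).
Proof.
rewrite -(of_modelK u) -(of_modelK v) -(of_modelK w).
rewrite -!to_model_morph -(linearB to_model) !to_model_isometry.
exact: symplectic_leibE.
Qed.

Lemma core_br_alternating a : br a a = 0.
Proof. by rewrite -proj_g_mul proj_g_ideal ?core_perp_sqr ?sec_g_perp. Qed.

(** [S Y a] is the class of [w], an element of Leib. Lifting that class back changes [w] only by an
    element of [I], which multiplies to zero, and [mul_leib] puts the product with [w] into [I]. *)
Lemma map_F_mapS X Y a : map_F X (mapS map_F map_G Y a) = 0.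
Proof.
rewrite add_lfunE map_FE map_FE map_GE -linearD /=.
set w := _ + _.
have wL : w \in leib mul by apply: leib_mem.
have wP : proj_h w = 0 by rewrite (linearD proj_h) /= !proj_h_mul addr0.
have e := core_decomposition w; rewrite wP linear0 add0r in e.
have := mul_leib (sec_h X) wL; rewrite {1}e mulDr.
rewrite (mul_core_ideal _ (sec_dual_ideal _)) addr0.
exact: proj_g_ideal.
Qed.

Lemma core_model :
  exists (F G : 'Hom(h, 'End(g))) (Omega : 'Hom(h, 'Hom(h, 'Hom(h, K^o))))
    (theta psi xi : {bilinear h -> h -> g}),
    [/\ forall X, derivation br (F X) /\ derivation br (G X),
        structure_equations br og F G Omega theta psi xi &
        symplectic_isomorphic mul om
          (model_mul br og F G Omega theta psi xi) mform].
Proof.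
exists map_F, map_G, map_Omega, map_theta, map_psi, map_xi.
have ndg := core_form_nondegenerate.
have lb := (model_leibnizP _ _ _ _ _ _ _ ndg).1 model_left_leibniz.
have sy := (model_symplecticP _ _ _ _ _ _ _ _).1 model_symplectic.
split.
- exact: (components_derivation ndg core_br_alternating lb).
- apply/(structure_equationsP _ _ _ _ _ _ _ ndg).
  have alt := core_br_alternating.
  exact: (components_structure ndg nz2 nz3 alt map_F_mapS lb sy).
exists to_model; split.
- exact: to_model_bij.
- exact: to_model_morph.
exact: to_model_isometry.
Qed.
End Forward.

(** * Nondegeneracy of the model form and assembly of both directions *)

Lemma model_form_nondegenerate (K : fieldType) (g h : vectType K)
    (og : {skew_symmetric g}) :
  nondegenerate og -> nondegenerate (model_form h og).
Proof.
move=> nd; apply/nondegenerateP => -[[X a] al] u0.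
have -> : a = 0.
  apply: (nondegenerate_eq0 nd) => b; have := u0 (0, b, 0).
  by rewrite /= linear0 zero_lfunE subrr add0r.
have -> : al = 0.
  apply/lfunP => Y; have := u0 (Y, 0, 0).
  by rewrite /= !zero_lfunE subr0 form0r addr0.
suff -> : X = 0 by [].
have dual0 (be : 'Hom(h, K^o)) : be X = 0.
  have := u0 (0, 0, be).
  by rewrite /= linear0 form0r addr0 sub0r => /eqP; rewrite oppr_eq0 => /eqP.
(* Each coordinate is itself a linear form on [h], so it vanishes at [X]. *)
rewrite (coord_vbasis (memvf X)) big1 // => i _.
have := dual0 (linfun (coord (vbasis {:h}) i : h -> K^o)).
by rewrite lfunE /= => ->; rewrite scale0r.
Qed.

Theorem theorem4p1 (K : fieldType) (char0 : [pchar K] =i pred0) :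
  (forall (A : vectType K) (mul : {bilinear A -> A -> A})
      (om : {skew_symmetric A}),
    symplectic_left_leibniz mul om ->
    let g := core_g mul om in
    let h := core_h mul om in
    let br : {bilinear g -> g -> g} := core_br mul om in
    let og : {skew_symmetric g} := core_form mul om in
    exists (F G : 'Hom(h, 'End(g))) (Omega : 'Hom(h, 'Hom(h, 'Hom(h, K^o))))
      (theta psi xi : {bilinear h -> h -> g}),
      [/\ forall X, derivation br (F X) /\ derivation br (G X),
          structure_equations br og F G Omega theta psi xi &
          symplectic_isomorphic mul om
            (model_mul br og F G Omega theta psi xi) (model_form h og)])
  /\
  (forall (g h : vectType K) (br : {bilinear g -> g -> g})
      (og : {skew_symmetric g}),
    symplectic_lie br og ->
    forall (F G : 'Hom(h, 'End(g))) (Omega : 'Hom(h, 'Hom(h, 'Hom(h, K^o))))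
      (theta psi xi : {bilinear h -> h -> g}),
      (forall X, derivation br (F X) /\ derivation br (G X)) ->
      structure_equations br og F G Omega theta psi xi ->
      symplectic_left_leibniz
        (model_mul br og F G Omega theta psi xi) (model_form h og)).
Proof.
have nz2 : 2 != 0 :> K by rewrite ((pcharf0P K).1 char0 2).
split=> [A mul om symp|g h br og lie F G Omega theta psi xi der eqs].
  exact: (core_model char0 symp).
have [_ nd _] := lie.
have st := (structure_equationsP _ _ _ _ _ _ _ nd).1 eqs.
apply/symplectic_left_leibnizP; split.
- apply/(model_leibnizP _ _ _ _ _ _ _ nd).
  exact: (structure_leibniz nd lie der st nz2).
- exact: model_form_nondegenerate.
apply/model_symplecticP.
exact: (structure_symplectic nd lie st nz2).
Qed.
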